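(* Let $N,k$ be positive integers with $k \le N$ and let $\mu$ be a finite Borel measure in $\mathbb{R}^N$ with $\dim_H \mu > k$. Then for almost every $k$-dimensional linear subspace $V \subset \mathbb{R}^N$ and every Borel set $Y \subset \mathbb{R}^N$ of full $\mu$-measure, the orthogonal projection $P_V\colon \mathbb{R}^N \to V$ is not injective on $Y$.
   Context: $\mathbb{R}^N$ carries the standard inner product and $P_V$ denotes the orthogonal projection onto $V$. ''Almost every $k$-dimensional linear subspace'' refers to the rotation-invariant (Haar) measure $\gamma_{k,N}$ on the Grassmannian $\mathrm{Gr}(k,N)$ of $k$-dimensional linear subspaces of $\mathbb{R}^N$. For a finite Borel measure $\mu$ in $\mathbb{R}^N$, the (upper) Hausdorff dimension is $\dim_H \mu = \inf\{\dim_H X : X \subset \mathbb{R}^N \text{ Borel with } \mu(\mathbb{R}^N \setminus X) = 0\}$, where $\dim_H X$ is the Hausdorff dimension of the set $X$. A set $Y$ is of full $\mu$-measure if $\mu(\mathbb{R}^N\setminus Y)=0$. *)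

(* Defs.v *)
From HB Require Import structures.
From mathcomp Require Import all_boot all_order all_algebra.
From mathcomp Require Import all_classical all_reals all_analysis.

Set Implicit Arguments.
Unset Strict Implicit.
Unset Printing Implicit Defensive.

Import Order.TTheory GRing.Theory Num.Theory.
Import numFieldNormedType.Exports.

Local Open Scope classical_set_scope.
Local Open Scope ring_scope.

Notation borel T := (g_sigma_algebraType (@open T)).

Definition full_measure d (T : measurableType d) (R : realType)
  (mu : set T -> \bar R) (Y : set T) := mu (~` Y) = 0%E.

Section euclidean.
Context {R : realType} {N : nat}.
Implicit Types (u v : 'rV[R]_N) (V : {vspace 'rV[R]_N}).

Definition dot u v : R := \sum_(i < N) u 0 i * v 0 i.

Fact dot_bilinear : bilinear_for
  (GRing.Scale.Law.clone _ _ *%R _) (GRing.Scale.Law.clone _ _ *%R _) dot.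
Proof.
split=> [v|v] a x y; rewrite /dot /= mulr_sumr -big_split /=;
  apply: eq_bigr => i _; rewrite !mxE.
- by rewrite mulrDl mulrA.
- by rewrite mulrDr mulrCA.
Qed.

HB.instance Definition _ :=
  bilinear_isBilinear.Build R 'rV[R]_N 'rV[R]_N R
    ( *%R : R -> R -> R) (idfun \; *%R : R -> R -> R) dot dot_bilinear.

Fact dot_sym u v : dot u v = (-1) ^+ false * idfun (dot v u).
Proof. by rewrite expr0 mul1r; apply: eq_bigr => i _; rewrite mulrC. Qed.

HB.instance Definition _ :=
  isHermitianSesquilinear.Build R 'rV[R]_N false idfun dot dot_sym.

Fact dot_gt0 u : u != 0 -> 0 < dot u u.
Proof.
move=> u0; have /existsP[i ui0] : [exists i, u 0 i != 0].
  apply: contraNT u0; rewrite negb_exists => /forallP u0.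
  by apply/eqP/rowP => j; rewrite mxE; apply/eqP; rewrite -[_ == _]negbK u0.
rewrite /dot (bigD1 i)//= ltr_wpDr ?sumr_ge0// => [j _|].
  by rewrite -expr2 sqr_ge0.
by rewrite -expr2 exprn_even_gt0.
Qed.

HB.instance Definition _ := isDotProduct.Build R 'rV[R]_N dot dot_gt0.

(* The norm that the library puts on 'rV[R]_N is the sup norm. *)
Definition enorm u : R := Num.sqrt (dot u u).

Definition orthproj V : 'End('rV[R]_N) := daddv_pi V (orthov dot V).

Lemma capv_orthov V : (V :&: orthov dot V = 0)%VS.
Proof.
apply/eqP; rewrite -subv0; apply/subvP => u; rewrite memv_cap memv0.
move=> /andP[uV /mem_orthovP /(_ u uV) uu]; apply: contra_eqT uu => u0.
by rewrite gt_eqF// dot_gt0.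
Qed.

Lemma addv_orthov V : (V + orthov dot V = fullv)%VS.
Proof.
pose f : 'rV[R]_N -> 'rV[R]_(\dim V) :=
  fun u => \row_i dot u (vbasis V)`_i.
have f_lin : linear f.
  by move=> a u v; apply/rowP => i; rewrite !mxE linearPl.
pose fL := GRing.isLinear.Build R _ _ _ f f_lin.
pose F : {linear 'rV[R]_N -> 'rV[R]_(\dim V)} := HB.pack f fL.
have kerF : (lker (linfun F) <= orthov dot V)%VS.
  apply/subvP => u; rewrite memv_ker lfunE => /eqP/rowP fu0.
  apply/subv_bigcapP => i _.
  by rewrite -memvE memv_ker lfunE; have := fu0 i; rewrite !mxE => /= ->.
apply/eqP; rewrite eqEdim subvf /= dimv_disjoint_sum ?capv_orthov//.
rewrite -(limg_ker_dim (linfun F) fullv) capfv addnC leq_add ?dimvS//.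
by rewrite (leq_trans (dimvS (subvf _)))// dimvf /dim /= mul1n.
Qed.

Lemma orthproj_mem V u : orthproj V u \in V.
Proof. exact: memv_pi. Qed.

Lemma orthproj_orth V u v : v \in V -> dot (u - orthproj V u) v = 0.
Proof.
have := daddv_pi_add (capv_orthov V) (_ : u \in _).
rewrite addv_orthov => /(_ (memvf u)) /esym uE; rewrite {1}uE addrC addKr.
by move=> vV; apply: (mem_orthovP (memv_pi _ _ _)).
Qed.

End euclidean.

Section hausdorff.
Context {R : realType} {N : nat}.
Implicit Types (X U : set 'rV[R]_N) (s delta : R).
Local Open Scope ereal_scope.

Definition diam U : \bar R :=
  ereal_sup [set (enorm (p.1 - p.2))%:E | p in U `*` U].

(* The case distinction gives |set0|^0 = 0, while |{x}|^0 = 1. *)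
Definition diam_pow s U : \bar R :=
  if U == set0 then 0 else diam U `^ s.

Definition hausdorff_premeasure s delta X : \bar R :=
  ereal_inf [set \sum_(0 <= i <oo) diam_pow s (U i) | U in
    [set U : (set 'rV[R]_N)^nat |
      X `<=` \bigcup_i U i /\ forall i, diam (U i) <= delta%:E]].

Definition hausdorff_measure s X : \bar R :=
  ereal_sup [set hausdorff_premeasure s delta X | delta in [set d | (0 < d)%R]].

Definition hausdorff_dim X : \bar R :=
  ereal_inf [set s%:E | s in [set s | (0 <= s)%R /\ hausdorff_measure s X = 0]].

Definition hausdorff_dim_measure (mu : set (borel 'rV[R]_N) -> \bar R) :
    \bar R :=
  ereal_inf [set hausdorff_dim X | X in
    [set X : set (borel 'rV[R]_N) | measurable X /\ full_measure mu X]].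

End hausdorff.

(* The proof of k <= N is a parameter because measurable types are pointed. *)
Record grassmannian (R : realType) (N k : nat) (kN : (k <= N)%N) := Grass {
  gspace :> {vspace 'rV[R]_N};
  _ : \dim gspace == k }.
Arguments grassmannian : clear implicits.
Arguments grassmannian R {N k} kN.

Section grassmannian.
Context {R : realType} {N k : nat} {kN : (k <= N)%N}.
Local Notation Gr := (grassmannian R kN).

HB.instance Definition _ := [isSub for @gspace R N k kN].
HB.instance Definition _ := [Choice of Gr by <:].

Fact gr_point_subproof :
  \dim <<take k (vbasis {:'rV[R]_N})>>%VS == k.
Proof.
have := basis_free (vbasisP {:'rV[R]_N}).
rewrite -{1}(cat_take_drop k (vbasis _)) => /catl_free; rewrite /free => /eqP ->.
by rewrite size_takel// size_tuple dimvf /dim /= mul1n.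
Qed.

HB.instance Definition _ := isPointed.Build Gr (Grass kN gr_point_subproof).

(* The topology of the embedding V |-> P_V into N x N matrices. *)
Definition gr_proj_mx (V : Gr) : 'M[R]_N := lin1_mx (orthproj V).

HB.instance Definition _ :=
  Topological.copy Gr (initial_topology gr_proj_mx).

Definition orthogonal_mx (g : 'M[R]_N) := g *m g^T == 1%:M.

Fact gr_act_subproof (g : 'M[R]_N) (V : Gr) :
  orthogonal_mx g -> \dim (linfun (mulmxr g) @: V)%VS == k.
Proof.
move=> /eqP gg; rewrite limg_dim_eq ?(valP V)//.
have /eqP -> : lker (linfun (mulmxr g : 'rV[R]_N -> 'rV[R]_N)) == 0%VS.
  apply/lker0P => u v; rewrite !lfunE /= => /(congr1 (mulmx^~ g^T)).
  by rewrite -!mulmxA gg !mulmx1.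
exact: capv0.
Qed.

Definition gr_act (g : 'M[R]_N) (og : orthogonal_mx g) (V : Gr) : Gr :=
  Grass kN (gr_act_subproof V og).

(* Invariance under O(N) is the same as under SO(N): a linear subspace is
   mapped to itself by some orthogonal matrix of determinant -1. *)
Definition rotation_invariant (gamma : set (borel Gr) -> \bar R) :=
  forall (g : 'M[R]_N) (og : orthogonal_mx g) (A : set (borel Gr)),
    measurable A -> gamma (gr_act og @^-1` A) = gamma A.

End grassmannian.

(* Main.v *)
Require Import Defs.
From mathcomp Require Import all_boot all_order all_algebra.
From mathcomp Require Import all_classical all_reals all_analysis.
From mathcomp Require Import measurable_realfun borel_hierarchy zify lra ring.

Set Implicit Arguments.
Unset Strict Implicit.
Unset Printing Implicit Defensive.

Import Order.TTheory GRing.Theory Num.Theory.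
Import numFieldNormedType.Exports.

Local Open Scope classical_set_scope.
Local Open Scope ring_scope.

(* If dim mu > k, pick s in (k, dim mu): by a maximal dyadic cube argument there
   is a set A of positive measure on which mu(Q) = O(l(Q)^s) for dyadic cubes Q of
   side l(Q). Hence the t-energy of mu on A is finite for t in (k, s), and since
   gamma [|P_V z| <= r] = O((r / |z|)^k), the integrals
     r^-k \int\int_(|P_V (x - y)| <= r) |x - y|^(k - t) dmu(x) dmu(y)
   over A x A have bounded gamma-average as r -> 0; by Fatou their lower limit is
   finite for almost every V. If P_V were injective on Y of full measure, it would
   be injective on a compact K in A :&: Y with mu(K) > 0; by compactness, points
   x, y of K with |P_V (x - y)| <= r are at distance o(1), so that |x - y|^(k - t)
   is large, whereas covering P_V(K) by O(r^-k) pieces of diameter <= r gives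
   (mu x mu) [x, y in K, |P_V (x - y)| <= r] >= c mu(K)^2 r^k. Hence the lower
   limit is infinite. All integrals over A x A are replaced by finite sums over
   pairs of dyadic cubes of side 2^-n. *)

(** * Euclidean geometry *)

Section euclidean_norm.
Context {R : realType} {N : nat}.
Implicit Types (u v w : 'rV[R]_N) (V : {vspace 'rV[R]_N}).

Lemma dotC u v : dot u v = dot v u.
Proof. by apply: eq_bigr => i _; rewrite mulrC. Qed.

Lemma dotDl u v w : dot (u + v) w = dot u w + dot v w.
Proof. by rewrite /dot -big_split; apply: eq_bigr => i _; rewrite mxE mulrDl. Qed.

Lemma dotZl a u v : dot (a *: u) v = a * dot u v.
Proof. by rewrite /dot mulr_sumr; apply: eq_bigr => i _; rewrite mxE mulrA. Qed.

Lemma dotDr u v w : dot u (v + w) = dot u v + dot u w.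
Proof. by rewrite dotC dotDl !(dotC u). Qed.

Lemma dotZr a u v : dot u (a *: v) = a * dot u v.
Proof. by rewrite dotC dotZl dotC. Qed.

Lemma dotBl u v w : dot (u - v) w = dot u w - dot v w.
Proof. by rewrite -scaleN1r dotDl dotZl mulN1r. Qed.

Lemma dotBr u v w : dot u (v - w) = dot u v - dot u w.
Proof. by rewrite dotC dotBl !(dotC u). Qed.

Lemma dot_ge0 u : 0 <= dot u u.
Proof. by apply: sumr_ge0 => i _; rewrite -expr2 sqr_ge0. Qed.

Lemma dot_mulmx (g : 'M[R]_N) u v :
  orthogonal_mx g -> dot (u *m g) (v *m g) = dot u v.
Proof.
have dotE (a b : 'rV[R]_N) : dot a b = (a *m b^T) 0 0.
  by rewrite mxE; apply: eq_bigr => i _; rewrite mxE.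
by move=> /eqP gg; rewrite !dotE trmx_mul mulmxA -(mulmxA u) gg mulmx1.
Qed.

Lemma enorm_mulmx (g : 'M[R]_N) u : orthogonal_mx g -> enorm (u *m g) = enorm u.
Proof. by move=> og; rewrite /enorm dot_mulmx. Qed.

Lemma sqr_enorm u : enorm u ^+ 2 = dot u u.
Proof. by rewrite sqr_sqrtr ?dot_ge0. Qed.

Lemma enorm_ge0 u : 0 <= enorm u.
Proof. exact: sqrtr_ge0. Qed.

Lemma enorm_gt0 u : u != 0 -> 0 < enorm u.
Proof. by move=> u0; rewrite sqrtr_gt0 dot_gt0. Qed.

Lemma enorm0 : enorm (0 : 'rV[R]_N) = 0.
Proof. by rewrite /enorm -(scale0r 0) dotZl mul0r sqrtr0. Qed.

Lemma enormZ a u : enorm (a *: u) = `|a| * enorm u.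
Proof. by rewrite /enorm dotZl dotZr mulrA -expr2 sqrtrM ?sqr_ge0// sqrtr_sqr.
  Qed.

Lemma enormN u : enorm (- u) = enorm u.
Proof. by rewrite -scaleN1r enormZ normrN1 mul1r. Qed.

Lemma dot_le u v : dot u v <= enorm u * enorm v.
Proof.
rewrite (le_trans (ler_norm _))// -(@ler_pXn2r _ 2)// ?nnegrE ?mulr_ge0
  ?enorm_ge0//.
rewrite exprMn !sqr_enorm real_normK ?num_real//.
have [->|v0] := eqVneq v 0; first by rewrite -(scale0r 0) !dotZr !mul0r mulr0
  expr0n.
(* The squared length of this vector is [dot v v] times the defect in the Cauchy-Schwarz
   inequality. *)
have := dot_ge0 (dot v v *: u - dot u v *: v).
rewrite !(dotBl, dotBr, dotZl, dotZr) (dotC v u).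
have := dot_gt0 v0; move: (dot v v) (dot u v) (dot u u) => a b c a0 h.
rewrite -(ler_pM2l a0) -subr_ge0 (le_trans h)// le_eqVlt; apply/orP; left.
by apply/eqP; ring.
Qed.

Lemma ler_enormD u v : enorm (u + v) <= enorm u + enorm v.
Proof.
rewrite -(@ler_pXn2r _ 2)// ?nnegrE ?addr_ge0 ?enorm_ge0//.
rewrite sqrrD !sqr_enorm dotDl !dotDr (dotC v u).
have := dot_le u v; move: (dot u v) (enorm u * _) => a b ab; lra.
Qed.

Lemma ler_enormB u v : enorm (u - v) <= enorm u + enorm v.
Proof. by rewrite -(enormN v) ler_enormD. Qed.

Lemma coord_le_enorm u i : `|u 0 i| <= enorm u.
Proof.
rewrite -(@ler_pXn2r _ 2)// ?nnegrE ?enorm_ge0// sqr_enorm real_normK ?num_real//.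
rewrite /dot (bigD1 i)//= -expr2 ler_wpDr// sumr_ge0// => j _.
by rewrite -expr2 sqr_ge0.
Qed.

Lemma enorm_le_coord u (c : R) : 0 <= c -> (forall i, `|u 0 i| <= c) ->
  enorm u <= N%:R * c.
Proof.
move=> c0 uc; rewrite -(@ler_pXn2r _ 2)// ?nnegrE ?mulr_ge0 ?enorm_ge0//.
rewrite sqr_enorm; have [N0|N0] := posnP N.
  by rewrite [dot _ _]big1 ?sqr_ge0// => i; have := ltn_ord i; rewrite {2}N0.
rewrite (@le_trans _ _ (\sum_(i < N) c ^+ 2))//.
  apply: ler_sum => i _; rewrite -expr2 -[_ ^+ 2]real_normK ?num_real//.
  by rewrite lerXn2r ?nnegrE.
rewrite sumr_const card_ord -[X in X <= _]mulr_natl exprMn ler_wpM2r ?sqr_ge0//.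
by rewrite -natrX ler_nat expnS leq_pmulr ?expn_gt0 ?N0.
Qed.

Lemma orthproj_unique V u v : v \in V -> (forall w,
  w \in V -> dot (u - v) w = 0) ->
  orthproj V u = v.
Proof.
move=> vV uv; apply/eqP; rewrite -subr_eq0; apply/negPn/negP => /dot_gt0.
set w := _ - v; have wV : w \in V by rewrite memvB ?orthproj_mem.
have -> : dot w w = dot (u - v) w - dot (u - orthproj V u) w.
  by rewrite -dotBl opprB addrC subrKA.
by rewrite uv ?orthproj_orth// subrr ltxx.
Qed.

Lemma enorm_orthproj V u : enorm (orthproj V u) <= enorm u.
Proof.
rewrite -(@ler_pXn2r _ 2)// ?nnegrE ?enorm_ge0// !sqr_enorm.
rewrite -[X in _ <= dot X X](subrK (orthproj V u)).
have h := orthproj_orth u (orthproj_mem V u).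
move: (u - _) h => w h.
by rewrite dotDl !dotDr h (dotC (orthproj V u) w) h add0r addr0 lerDr dot_ge0.
Qed.

Lemma dot_orthproj V u v : v \in V -> dot (orthproj V u) v = dot u v.
Proof. by move=> vV; apply/esym/eqP; rewrite -subr_eq0 -dotBl orthproj_orth. Qed.

(* A Householder reflection. *)
Lemma orthogonal_mx_trans u v : enorm u = enorm v ->
  exists2 g : 'M[R]_N, orthogonal_mx g & u *m g = v.
Proof.
move=> uv; have [<-|nuv] := eqVneq u v.
  by exists 1%:M; rewrite ?mulmx1// /orthogonal_mx trmx1 mulmx1.
have [w wE] : exists w, w = u - v by exists (u - v).
have w0 : 0 < dot w w by rewrite wE dot_gt0 ?subr_eq0.
pose c := 2 / dot w w; pose g := 1%:M - c *: (w^T *m w).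
have ww : w *m w^T = (dot w w)%:M.
  apply/matrixP => i j; rewrite !ord1 !mxE eqxx.
  by apply: eq_bigr => l _; rewrite !mxE.
have uw : u *m w^T = (dot u w)%:M.
  apply/matrixP => i j; rewrite !ord1 !mxE eqxx.
  by apply: eq_bigr => l _; rewrite !mxE.
have gT : g^T = g by rewrite /g linearB /= trmx1 linearZ /= trmx_mul trmxK.
exists g.
  rewrite /orthogonal_mx gT /g mulmxBl mul1mx -scalemxAl mulmxBr mulmx1.
  rewrite -scalemxAr mulmxA -(mulmxA w^T) ww mul_mx_scalar -scalemxAl scalerA.
  rewrite [c * _]divfK ?gt_eqF// scaler_nat mulr2n opprD addrA subrr add0r.
  by rewrite scalerN opprK subrK.
rewrite mulmxBr mulmx1 -scalemxAr mulmxA uw mul_scalar_mx scalerA.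
suff -> : c * dot u w = 1 by rewrite scale1r wE opprB addrC subrK.
(* Equality of the lengths enters here: it makes [dot u u - dot u v] half of [dot w w], so the
   reflection subtracts exactly [w] from [u]. *)
suff ww2 : 2 * dot u w = dot w w by rewrite /c mulrAC ww2 divff ?gt_eqF.
have := sqr_enorm u; rewrite uv sqr_enorm => vu.
by rewrite wE !(dotBl, dotBr) (dotC v u) vu; ring.
Qed.

End euclidean_norm.

Lemma borel_measurable_closed (T : ptopologicalType) (F : set T) :
  closed F -> measurable (F : set (borel T)).
Proof.
move=> /closed_openC oF; rewrite -[X in measurable X]setCK; apply: measurableC.
exact: sub_sigma_algebra.
Qed.

(** * The orthogonal group acting on the Grassmannian *)

Section grassmannian_action.
Context {R : realType} {N k : nat} {kN : (k <= N)%N}.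
Local Notation Gr := (grassmannian R kN).

Lemma orthproj_gr_act (g : 'M[R]_N) (og : orthogonal_mx g) (V : Gr) u :
  orthproj (gr_act og V) (u *m g) = orthproj V u *m g.
Proof.
apply: orthproj_unique => [|w].
  by have := memv_img (linfun (mulmxr g)) (orthproj_mem V u); rewrite lfunE.
move=> /memv_imgP[v vV ->]; rewrite lfunE /= -mulmxBl dot_mulmx//.
exact: orthproj_orth.
Qed.

Lemma coord_orthprojE (V : Gr) u i :
  orthproj V u 0 i = \sum_j u 0 j * gr_proj_mx V j i.
Proof. have -> : orthproj V u = u *m gr_proj_mx V by rewrite /gr_proj_mx
  mul_rV_lin1.
by rewrite mxE.
Qed.

(** The topology of [Gr] is initial for [gr_proj_mx], so the matrix entries are continuous, and the
    coordinate is a fixed linear combination of them. *)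
Lemma continuous_orthproj u i : continuous (fun V : Gr => orthproj V u 0 i).
Proof.
have cg : continuous (gr_proj_mx : Gr -> 'M[R]_N)
  by exact: (@initial_continuous Gr 'M[R]_N gr_proj_mx).
under eq_fun do rewrite coord_orthprojE.
apply: continuous_big => [[a b]|j _]; first exact: add_continuous.
move=> V; apply: continuousM; first exact: cst_continuous.
apply: (@continuous_comp _ _ _ gr_proj_mx (fun M : 'M[R]_N => M j i));
  first exact: cg.
exact: coord_continuous.
Qed.

Lemma continuous_enorm_orthproj u :
  continuous (fun V : Gr => enorm (orthproj V u)).
Proof.
move=> V; rewrite /enorm /dot; apply: continuous_comp;
  last exact: sqrt_continuous.
apply: continuous_big => [[a b]|i _ W]; first exact: add_continuous.
apply: continuousM; exact: continuous_orthproj.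
Qed.

Lemma measurable_orthproj_le u (r : R) :
  measurable ([set V | enorm (orthproj V u) <= r] : set (borel Gr)).
Proof.
apply: borel_measurable_closed.
apply: (preimage_closed _ (@closed_le _ r)) => V _.
exact: continuous_enorm_orthproj.
Qed.

(** A reflection takes [u] to [v], and its action on subspaces is compatible with the projections;
    so the law of |P_V u| depends only on |u|. *)
Lemma gamma_orthproj_eq (gamma : probability (borel Gr) R) u v (r : R) :
  rotation_invariant gamma -> enorm u = enorm v ->
  gamma [set V | enorm (orthproj V u) <= r] =
  gamma [set V | enorm (orthproj V v) <= r].
Proof.
move=> inv uv; have [g og <-] := orthogonal_mx_trans uv.
rewrite -[RHS](inv g og _ (measurable_orthproj_le _ _)).
apply: (congr1 gamma); apply/funext => V.
change ((enorm (orthproj V u) <= r) =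
  (enorm (orthproj (gr_act og V) (u *m g)) <= r) :> Prop).
by rewrite orthproj_gr_act enorm_mulmx.
Qed.
End grassmannian_action.

(** * Grid points close to the kernel of a projection *)

(** Cramer's rule, turning an entry into a minor: all columns of the new matrix except column [i]
    are unit vectors, so the expansion along column [i] leaves only the cofactor at (i, i), which is
    1. *)
Lemma det_colsub_upd (R : comRingType) (k N : nat) (f : {ffun 'I_k -> 'I_N})
    (M : 'M[R]_(k, N)) (i : 'I_k) (j : 'I_N) : colsub f M = 1%:M ->
  \det (colsub [ffun l => if l == i then j else f l] M) = M i j.
Proof.
move=> f1; set G := colsub _ M.
have GE l c : c != i -> G l c = (l == c)%:R.
  move=> ci; rewrite !mxE ffunE (negPf ci).
  by have /matrixP/(_ l c) := f1; rewrite !mxE.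
have Gi l : G l i = M l j by rewrite !mxE ffunE eqxx.
rewrite (expand_det_col G i) (bigD1 i)//= Gi big1 ?addr0 => [|l li].
  rewrite /cofactor addnn -signr_odd odd_double expr0 mul1r.
  suff -> : row' i (col' i G) = 1%:M by rewrite det1 mulr1.
  apply/matrixP => a b; rewrite 2![in LHS]mxE GE; last by rewrite eq_sym neq_lift.
  by rewrite !mxE (inj_eq lift_inj).
have [r ri _] := unlift_some (li : l != i).
rewrite /cofactor (expand_det_row _ r) big1 ?mulr0// => c _.
rewrite 2![X in X * _]mxE GE; last by rewrite eq_sym neq_lift.
by rewrite -ri (negPf (neq_lift _ _)) mul0r.
Qed.

Section projection_of_grid.
Context {R : realType} {N : nat}.
Implicit Types (V : {vspace 'rV[R]_N}).

(* Among all k x k minors of a basis matrix of V pick the largest: by Cramer's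
   rule the basis dual to it has coefficients bounded by 1. *)
Lemma bounded_dual_basis V k : \dim V = k ->
  exists (f : {ffun 'I_k -> 'I_N}) (M : 'M[R]_(k, N)),
    [/\ forall i, row i M \in V, colsub f M = 1%:M, forall i j, `|M i j| <= 1 &
        forall v, v \in V -> v = \sum_l v 0 (f l) *: row l M].
Proof.
move=> Vk; pose B : 'M[R]_(k, N) := \matrix_(i < k) (vbasis V)`_i.
have rB : row_free B.
  apply: inj_row_free => u uB; apply/rowP => i; rewrite mxE.
  have /freeP h := basis_free (vbasisP V).
  have {}h := h (fun l => u 0 (cast_ord Vk l)).
  rewrite -(cast_ordKV Vk i); apply: h; apply: etrans uB; rewrite mulmx_sum_row.
  rewrite [RHS](reindex (cast_ord Vk))/=; last by exists (cast_ord (esym Vk)) =>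
    x _; rewrite ?cast_ordK ?cast_ordKV.
  by apply: eq_bigr => l _; rewrite rowK.
have fB : row_full B^T by rewrite /row_full mxrank_tr.
pose D (f : {ffun 'I_k -> 'I_N}) := \det (colsub f B).
have [f0 Df0] : exists f, D f != 0.
  exists [ffun i => fullrankfun fB i].
  suff -> : D [ffun i => fullrankfun fB i] = \det (rowsub (fullrankfun fB) B^T)^T.
    by rewrite det_tr -unitfE -unitmxE -row_full_unit fullrowsub_full.
  by congr (\det _); apply/matrixP => a b; rewrite !mxE ffunE.
case: (@Order.TotalTheory.arg_maxP _ R _ f0 predT (fun f => `|D f|) isT) =>
  f _ fmax.
have Df : D f != 0 by rewrite -normr_gt0 (lt_le_trans _ (fmax f0 isT))//
  normr_gt0.
have uf : colsub f B \in unitmx by rewrite unitmxE unitfE.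
pose M := invmx (colsub f B) *m B.
have BM : B = colsub f B *m M by rewrite mulKVmx.
have subM g : colsub g M = invmx (colsub f B) *m colsub g B.
  by apply/matrixP => a b; rewrite !mxE; apply: eq_bigr => c _; rewrite !mxE.
have Mf : colsub f M = 1%:M by rewrite subM mulVmx.
exists f, M; split=> // [i|i j|v vV].
  rewrite rowE mulmxA mulmx_sum_row memv_suml// => l _; rewrite memvZ// rowK.
  by rewrite (vbasis_mem (mem_nth _ _))// size_tuple Vk.
  (* The entry is the ratio of the minors [D g] and [D f], where [g] is [f] with [i] sent to [j];
     maximality of [f] bounds it. *)
  rewrite -(det_colsub_upd _ _ Mf); set g : {ffun _ -> _} := finfun _.
  have : `|D g| <= `|D f| := fmax g isT; rewrite /D.
  have -> : colsub g B = colsub f B *m colsub g M by rewrite subM mulKVmx.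
  by rewrite det_mulmx normrM ger_pMr ?normr_gt0.
pose c := \row_(i < k) coord (vbasis V) (cast_ord (esym Vk) i) v.
have vE : v = (c *m colsub f B) *m M.
  rewrite -mulmxA -BM mulmx_sum_row {1}(coord_vbasis vV).
  rewrite (reindex (cast_ord (esym Vk)))/=; last first.
    by exists (cast_ord Vk) => x _; rewrite ?cast_ordK ?cast_ordKV.
  by apply: eq_bigr => l _; rewrite rowK mxE.
rewrite {1}vE mulmx_sum_row; apply: eq_bigr => l _; congr (_ *: _).
have <- : (c *m colsub f B *m colsub f M) 0 l = v 0 (f l).
  by rewrite [in RHS]vE !mxE; apply: eq_bigr => l' _; rewrite !mxE.
by rewrite Mf mulmx1.
Qed.

Definition grid_vec n (p : {ffun 'I_N -> 'I_n}) : 'rV[R]_N := \row_i (p i)%:R.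

(** The N - k coordinates outside the image of [f] are free. Two counted points that agree there
    differ by a vector supported on the image of [f], which [V] nearly contains: its norm is at most
    kN times that of its projection. Hence each remaining coordinate is determined by its residue
    modulo T + 1. *)
Lemma card_grid_orthproj k (c : R) : exists C : nat, forall V n, \dim V = k ->
  (#|[pred p : {ffun 'I_N -> 'I_n} | (enorm (orthproj V (grid_vec p)) <= c)%R]| <=
    C * n ^ (N - k))%N.
Proof.
pose T := Num.truncn (2 * c * (k * N)%:R).
exists (T.+1 ^ k)%N => V n /bounded_dual_basis[f [M [MV Mf M1 _]]].
have f_inj : injective f.
  move=> a b fab; have /matrixP/(_ a b) := Mf; have /matrixP/(_ a a) := Mf.
  rewrite !mxE fab eqxx => -> /eqP; case: (a =P b) => //=.
  by rewrite oner_eq0.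
have key (u : 'rV[R]_N) : (forall j, j \notin codom f -> u 0 j = 0) ->
    enorm u <= (k * N)%:R * enorm (orthproj V u).
  move=> uf; have [->|u0] := eqVneq u 0; first by rewrite enorm0 mulr_ge0//
    enorm_ge0.
  (* A vector of [V] with the same coordinates as [u] at the places [f l]; as [u] vanishes
     elsewhere, [dot u v] is the square of [enorm u]. *)
  pose v := \sum_l u 0 (f l) *: row l M.
  have vV : v \in V by rewrite memv_suml// => l _; rewrite memvZ.
  have uv : dot u v = enorm u ^+ 2.
    rewrite sqr_enorm /dot (bigID (mem (codom f)))/=.
    rewrite [RHS](bigID (mem (codom f)))/=; congr (_ + _); last first.
      by apply: eq_bigr => j /uf ->; rewrite !mul0r.
    apply: eq_bigr => _ /codomP[l ->]; congr (_ * _).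
    rewrite /v summxE (bigD1 l)//= big1 ?addr0 => [|l' l'l].
      by rewrite !mxE; have /matrixP/(_ l l) := Mf; rewrite !mxE eqxx => ->;
        rewrite mulr1.
    by rewrite !mxE; have /matrixP/(_ l' l) := Mf; rewrite !mxE (negPf l'l) =>
      ->; rewrite mulr0.
  have ve : enorm v <= (k * N)%:R * enorm u.
    rewrite mulnC natrM -mulrA; apply: enorm_le_coord => [|j].
      by rewrite mulr_ge0 ?enorm_ge0.
    rewrite /v summxE (le_trans (ler_norm_sum _ _ _))//.
    rewrite mulr_natl -[X in _ *+ X]card_ord -sumr_const ler_sum// => l _.
    rewrite !mxE normrM (le_trans _ (coord_le_enorm u (f l)))//.
    by rewrite ler_piMr ?normr_ge0.
  rewrite -(ler_pM2r (enorm_gt0 u0)) -expr2 -uv -(dot_orthproj _ vV).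
  apply: (le_trans (dot_le _ _)); apply: (le_trans (ler_wpM2l (enorm_ge0 _) ve)).
  by rewrite mulrCA mulrA.
set S := [pred p : {ffun 'I_N -> 'I_n} | (enorm (orthproj V (grid_vec p)) <=
  c)%R].
pose J := {j : 'I_N | j \notin codom f}.
pose h (p : {ffun 'I_N -> 'I_n}) : {ffun J -> 'I_n} * {ffun 'I_k -> 'I_T.+1} :=
  ([ffun j : J => p (val j)], [ffun l => inord (p (f l) %% T.+1)]).
have h_inj : {in S &, injective h}.
  move=> p p'; rewrite !inE => pc p'c [hJ hT].
  have pJ j : j \notin codom f -> p j = p' j.
    by move=> jf; have /ffunP/(_ (exist _ j jf)) := hJ; rewrite !ffunE.
  have := key (grid_vec p - grid_vec p').
  have : enorm (orthproj V (grid_vec p - grid_vec p')) <= 2 * c.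
    by rewrite linearB mulr2n mulrDl mul1r (le_trans (ler_enormB _ _))// lerD.
  move=> pp' key'.
  have {key'}epp' : enorm (grid_vec p - grid_vec p') <=
      (k * N)%:R * enorm (orthproj V (grid_vec p - grid_vec p')).
    by apply: key' => j jf; rewrite !mxE pJ// subrr.
  apply/ffunP => j; have [/codomP[l ->{j}]|/pJ//] := boolP (j \in codom f).
  have /ffunP/(_ l) := hT; rewrite !ffunE => /(congr1 val) /=.
  rewrite !inordK ?ltn_pmod// => /eqP pp'T; apply: val_inj => /=.
  have : `|(p (f l))%:R - (p' (f l))%:R| < T.+1%:R :> R.
    rewrite (le_lt_trans _ (truncnS_gt _))//.
    have := coord_le_enorm (grid_vec p - grid_vec p') (f l); rewrite !mxE.
    move=> /le_trans; apply; by rewrite (le_trans epp')// mulrC ler_wpM2r.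
  move: (nat_of_ord _) (nat_of_ord _) pp'T => {pp' pc p'c hJ hT epp' pJ} a b.
  wlog ab : a b / (a <= b)%N => [hw|].
    by have [/hw//|/ltnW/hw] := leqP a b; rewrite eq_sym distrC => hh /hh{}hh /hh.
  rewrite eqn_mod_dvd// -natrB// normr_nat ltr_nat => dab ltT.
  apply/eqP; rewrite eqn_leq ab andbT -subn_eq0; apply: contraTT dab;
    rewrite -lt0n => ba.
  by rewrite gtnNdvd.
rewrite -(card_in_imset h_inj) (leq_trans (max_card _))//.
rewrite card_prod !card_ffun !card_ord mulnC leq_mul//.
suff -> : #|{: J}| = (N - k)%N by [].
have := cardC (mem (codom f)); rewrite (card_codom f_inj) !card_ord => /esym NE.
rewrite card_sig [X in (X - _)%N]NE addKn.
by apply: eq_card => j; rewrite !inE.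
Qed.
End projection_of_grid.

(** * Measure of the subspaces that contract a vector *)

Lemma integral_sum_indic d (T : measurableType d) (R : realType)
    (mu : {measure set T -> \bar R}) (I : finType) (w : I -> R) (A : I -> set T) :
  (forall i, 0 <= w i) -> (forall i, measurable (A i)) ->
  (\int[mu]_x (\sum_i w i * \1_(A i) x)%:E = \sum_i (w i)%:E * mu (A i))%E.
Proof.
move=> w0 mA; have mw i : measurable_fun setT (fun x => (w i * \1_(A i) x)%:E).
  by apply/measurable_EFinP; apply: measurable_funM => //;
    exact: measurable_indic.
under eq_integral do rewrite -sumEFin.
rewrite ge0_integral_sum//=; last by move=> i x _; rewrite lee_fin mulr_ge0.
apply: eq_bigr => i _; under eq_integral do rewrite EFinM.
rewrite ge0_integralZl_EFin//= ?integral_indic ?setIT//.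
by apply/measurable_EFinP; exact: measurable_indic.
Qed.

Section projection_estimate.
Context {R : realType} {N k : nat} {kN : (k <= N)%N}.
Local Notation Gr := (grassmannian R kN).

(* By invariance, the measure on the left is at most that of
   [|P_V p| <= N] for each of the D^N grid points p; sum over p and use that for
   fixed V only O(D^(N-k)) grid points satisfy the inequality. *)
Lemma gamma_orthproj_le (gamma : probability (borel Gr) R) :
  rotation_invariant gamma -> exists2 C : R, 0 <= C &
  forall (z : 'rV[R]_N) (D : nat), (0 < D)%N -> D%:R <= enorm z ->
    (gamma [set V | (enorm (orthproj V z) <= 1)%R] <= (C / D%:R ^+ k)%:E)%E.
Proof.
move=> inv; have [C0 C0P] := @card_grid_orthproj R N k N%:R.
exists C0%:R => // z D D0 Dz.
set S := (X in gamma X).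
pose A (p : {ffun 'I_N -> 'I_D}) : set (borel Gr) :=
  [set V : Gr | enorm (orthproj V (grid_vec p)) <= N%:R].
have mA p : measurable (A p) by exact: measurable_orthproj_le.
have SA p : (gamma S <= gamma (A p))%E.
  have [p0|p0] := eqVneq (grid_vec p : 'rV[R]_N) 0.
    apply: le_measure; rewrite ?inE//; first exact: measurable_orthproj_le.
    by move=> V _; rewrite /A /= p0 linear0 enorm0 ler0n.
  have pN : enorm (grid_vec p : 'rV[R]_N) <= N%:R * D%:R.
    by apply: enorm_le_coord => // i; rewrite mxE normr_nat ler_nat ltnW.
  have z0 : 0 < enorm z by rewrite (lt_le_trans _ Dz) ?ltr0n.
  (* The factor that gives the grid vector the length of [z]. As |p| <= N D and D <= |z|, undoing
     the scaling turns the bound 1 into at most N. *)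
  pose a := enorm z / enorm (grid_vec p : 'rV[R]_N).
  have a0 : 0 < a by rewrite divr_gt0// enorm_gt0.
  rewrite /S (@gamma_orthproj_eq _ _ _ _ _ z (a *: grid_vec p))//; last first.
    by rewrite enormZ gtr0_norm// divfK// gt_eqF ?enorm_gt0.
  apply: le_measure; rewrite ?inE//; first exact: measurable_orthproj_le.
  move=> V; rewrite /A /= linearZ /= enormZ gtr0_norm//.
  rewrite -ler_pdivlMl// mulr1 => /le_trans; apply.
  rewrite invf_div ler_pdivrMr// (le_trans pN)// ler_wpM2l//.
have int_sum := integral_sum_indic gamma (fun=> ler01) mA.
have : (\int[gamma]_x (\sum_p 1 * \1_(A p) x)%:E <= (C0 * D ^ (N - k))%:R%:E)%E.
  rewrite -[leRHS]mule1 -(@probability_setT _ _ _ gamma) -integral_cst//.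
  apply: ge0_le_integral => //=.
  - by move=> V _; rewrite lee_fin sumr_ge0// => p _; rewrite mul1r.
  - apply/measurable_EFinP; apply: measurable_sum => p.
    by apply: measurable_funM => //; exact: measurable_indic.
  - move=> V _; have /eqP Vk := valP V.
    rewrite lee_fin (le_trans _ (_ : #|[pred p : {ffun 'I_N -> 'I_D} |
      enorm (orthproj V (grid_vec p)) <= N%:R]|%:R <= _)) ?ler_nat ?C0P//.
    rewrite -sum1_card natr_sum [leRHS]big_mkcond/=; apply: ler_sum => p _.
    rewrite mul1r indicE; case: ifPn => [_|/negP nA]; last by rewrite memNset.
    by rewrite ler_nat leq_b1.
rewrite int_sum; have gS : gamma S = (fine (gamma S))%:E.
  by rewrite fineK// fin_num_measure//; exact: measurable_orthproj_le.
have : (((D ^ N)%:R * fine (gamma S))%:E <= \sum_p 1%:E * gamma (A p))%E.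
  rewrite -[N in (_ ^ N)%N]card_ord -[D in (D ^ _)%N]card_ord -card_ffun.
  rewrite mulr_natl -sumr_const -sumEFin; apply: lee_sum => p _.
  by rewrite mul1e -gS.
move=> /le_trans/[apply]; rewrite gS !lee_fin natrM !natrX => le.
have D0r : 0 < D%:R :> R by rewrite ltr0n.
rewrite ler_pdivlMr ?exprn_gt0//.
rewrite -(ler_pM2l (exprn_gt0 (N - k) D0r)) mulrC -mulrA -exprD addnC subnK//.
by rewrite mulrC (le_trans le)// mulrC.
Qed.
End projection_estimate.

(** * Dyadic cubes and Hausdorff measure *)

Section dyadic_cubes.
Context {R : realType} {N : nat}.
Local Notation E := 'rV[R]_N.
Implicit Types (x y : E) (q : {ffun 'I_N -> int}).

Definition dyadic_index n x : {ffun 'I_N -> int} :=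
  [ffun i => Num.floor (2 ^+ n * x 0 i)].

Definition dyadic_cube n q : set E := [set x | dyadic_index n x = q].

Lemma measurable_coord_le i (a : R) : 
  measurable ([set x : E | x 0 i <= a] : set (borel E)).
Proof.
apply: borel_measurable_closed.
by apply: (preimage_closed _ (@closed_le _ a)) => x _; exact: coord_continuous.
Qed.

Lemma measurable_coord_ge i (a : R) : 
  measurable ([set x : E | a <= x 0 i] : set (borel E)).
Proof.
apply: borel_measurable_closed.
by apply: (preimage_closed _ (@closed_ge _ a)) => x _; exact: coord_continuous.
Qed.

Lemma measurable_dyadic_cube n q : measurable (dyadic_cube n q : set (borel E)).
Proof.
have -> : dyadic_cube n q = \bigcap_(i in [set: 'I_N])
    ([set x | (q i)%:~R / 2 ^+ n <= x 0 i] `\` [set x | (q i + 1)%:~R / 2 ^+ n <=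
      x 0 i]).
  apply/seteqP; split => x; rewrite /dyadic_cube /=.
    move=> <- i _ /=; rewrite ffunE !ler_pdivrMr ?exprn_gt0// mulrC floor_le;
      split=> //.
    by apply/negP; rewrite -ltNge floorD1_gt.
  move=> xq; apply/ffunP => i; have [] := xq i Logic.I; rewrite /= ffunE.
  rewrite !ler_pdivrMr ?exprn_gt0// mulrC => qx /negP; rewrite -ltNge => xq1.
  by apply/eqP; rewrite floor_eq qx.
apply: fin_bigcap_measurable => [|i _]; first exact: finite_finset.
by apply: measurableD; exact: measurable_coord_ge.
Qed.

Lemma dyadic_index_nested m n x y : (m <= n)%N ->
  dyadic_index n x = dyadic_index n y -> dyadic_index m x = dyadic_index m y.
Proof.
move=> mn xy; apply/ffunP => i; have /ffunP/(_ i) := xy; rewrite !ffunE => {}xy.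
(* The coarse floor is determined by comparing the fine floor with multiples of 2^(n - m). *)
have floorE (z : R) (c : int) : (c <= Num.floor (2 ^+ m * z)) =
    (c * 2 ^+ (n - m) <= Num.floor (2 ^+ n * z)).
  rewrite !floor_ge_int intrM rmorphXn /= -(subnKC mn) exprD addKn.
  by rewrite mulrAC ler_pM2r ?exprn_gt0.
by apply/eqP; rewrite eq_le floorE -xy -floorE lexx floorE xy -floorE lexx.
Qed.

Lemma dyadic_cube_coord n q x y : dyadic_cube n q x -> dyadic_cube n q y ->
  forall i, `|x 0 i - y 0 i| <= (2 ^+ n)^-1.
Proof.
move=> <- xy i; have /ffunP/(_ i) := xy; rewrite !ffunE => {}xy.
have n0 : 0 < 2 ^+ n :> R by rewrite exprn_gt0.
rewrite -[leRHS]mul1r ler_pdivlMr// -(gtr0_norm n0) -normrM mulrC mulrBr.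
have := floor_itv (2 ^+ n * x 0 i); have := floor_itv (2 ^+ n * y 0 i).
rewrite xy intrD; move: (_ * _) (_ * _) => a b; move: (_%:~R) => c.
move=> /andP[? ?] /andP[? ?]; rewrite ler_norml; apply/andP; split; lra.
Qed.

Lemma diam_dyadic_cube n q : (diam (dyadic_cube n q) <= (N%:R / 2 ^+ n)%:E)%E.
Proof.
apply: ge_ereal_sup => _ [[x y] /= [xq yq] <-]; rewrite lee_fin.
apply: enorm_le_coord => [|i]; first by rewrite invr_ge0 exprn_ge0.
by rewrite !mxE; exact: (dyadic_cube_coord xq yq).
Qed.

End dyadic_cubes.

(** * A set of positive measure with controlled mass on dyadic cubes *)

Section frostman.
Context {R : realType} {N : nat}.
Local Notation E := 'rV[R]_N.
Variables (mu : {finite_measure set (borel E) -> \bar R}) (s : R).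
Hypothesis s0 : 0 <= s.

(** The threshold is L times the s-th power of the side 2^-n. *)
Let heavy (L n : nat) (q : {ffun 'I_N -> int}) :=
  ((L%:R / (2 `^ s) ^+ n)%:E < mu (dyadic_cube n q))%E.

Let b_gt0 : 0 < 2 `^ s :> R. Proof. exact: powR_gt0. Qed.

Let b_ge1 : 1 <= 2 `^ s :> R.
Proof. by rewrite -[leLHS](powRr0 2) ler_powR ?ler1n. Qed.

Let mu_fin A : measurable (A : set (borel E)) -> mu A = (fine (mu A))%:E.
Proof. by move=> mA; rewrite fineK// fin_num_measure. Qed.

Let heavy_antimono L L' n q : (L <= L')%N -> heavy L' n q -> heavy L n q.
Proof.
by move=> LL'; apply: le_lt_trans; rewrite lee_fin ler_pM2r ?ler_nat//.
Qed.

(* The maximal heavy cubes are disjoint, so the sum of the s-th powers of their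
   diameters is O(mu(E) / L). *)
Lemma hausdorff_measure_heavy (X : set E) :
  (forall x, X x -> forall L, exists n, heavy L n (dyadic_index n x)) ->
  hausdorff_measure s X = 0%E.
Proof.
move=> XP; pose M := fine (mu setT).
have M0 : 0 <= M by exact: fine_ge0.
have mu_le (A : set (borel E)) : measurable A -> (mu A <= M%:E)%E.
  by move=> mA; rewrite -mu_fin// le_measure// inE.
have diam_ge0 (U : set E) : U !=set0 -> (0 <= diam U)%E.
  move=> [x Ux]; apply: ereal_sup_ubound; exists (x, x) => //=.
  by rewrite subrr enorm0.
have diam_pow_ge0 (U : set E) : (0 <= diam_pow s U)%E.
  by rewrite /diam_pow; case: ifP => // _; exact: poweR_ge0.
have premeasure_ge0 delta : (0 <= hausdorff_premeasure s delta X)%E.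
  by apply: le_ereal_inf_tmp => _ [U _ <-]; exact: nneseries_ge0.
apply/eqP; rewrite eq_le; apply/andP; split; last first.
  by apply: (le_trans (premeasure_ge0 1)); apply: ereal_sup_ubound; exists 1 =>
    //=; exact: ltr01.
apply: ge_ereal_sup => _ [delta /= delta0 <-].
apply/lee_addgt0Pr => e e0; rewrite add0e.
have [n0 Nn0] : exists n0, N%:R / 2 ^+ n0 <= delta.
  exists (Num.truncn (N%:R / delta)).+1.
  rewrite ler_pdivrMr ?exprn_gt0// mulrC -ler_pdivrMr// (le_trans (ltW
    (truncnS_gt _)))//.
  by rewrite -natrX ler_nat ltnW// ltn_expl.
(* The first bound on [L] excludes heavy cubes at levels below [n0], so the selected cubes have
   diameter at most [delta]; the second makes the sum of the powers of their diameters at most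
   [e]. *)
have [L [L0 Ln0 Le]] : exists L : nat, [/\ (0 < L)%N, M * (2 `^ s) ^+ n0 <= L%:R &
    N%:R `^ s * M / L%:R <= e].
  exists ((Num.truncn (M * (2 `^ s) ^+ n0)).+1 + (Num.truncn (N%:R `^ s * M /
    e)).+1)%N.
  split=> //.
    by rewrite natrD ler_wpDr// ltW// truncnS_gt.
  rewrite ler_pdivrMr ?ltr0n// -ler_pdivrMl// mulrC.
  by rewrite natrD ler_wpDl// ltW// truncnS_gt.
pose sel n q := heavy L n q /\ forall (x : E) m,
  dyadic_index n x = q -> (m < n)%N ->
  ~ heavy L m (dyadic_index m x).
(* Codes of pairs (level, index) enumerate the selected cubes; every other code gives [set0], whose
   [diam_pow] is 0 by convention. *)
pose U j : set E := if pickle_inv j is Some a then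
  (if `[< sel a.1 a.2 >] then dyadic_cube a.1 a.2 else set0) else set0.
have mU j : measurable (U j : set (borel E)).
  rewrite /U; case: pickle_inv => [a|//]; case: asboolP => // _.
  exact: measurable_dyadic_cube.
have UP j x : U j x -> exists n, [/\ j = pickle (n, dyadic_index n x),
    sel n (dyadic_index n x) & U j = dyadic_cube n (dyadic_index n x)].
  rewrite /U; case: pickle_inv (@pickle_invK (nat * {ffun 'I_N -> int})%type j)
    => [[n q]|//] /= <-.
  by case: asboolP => // sel_nq xq; exists n; rewrite xq.
have tU : trivIset setT U.
  move=> i j _ _ [x [/UP[n [-> [hn nmin] _]] /UP[m [-> [hm mmin] _]]]].
  case: (ltngtP m n) => [mn|nm|->//].
    by case: (nmin x m erefl mn).
  by case: (mmin x n erefl nm).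
have diamU j : (diam_pow s (U j) <= (N%:R `^ s / L%:R)%:E * mu (U j))%E.
  rewrite /diam_pow; case: eqP => [->|/eqP/set0P[x Ux]];
    first by rewrite measure0 mule0.
  have [n [_ [hn _] UE]] := UP _ _ Ux.
  apply: (@le_trans _ _ ((N%:R / 2 ^+ n)%:E `^ s)%E).
    apply: gt0_ler_poweR => //.
    - by rewrite in_itv /= leey diam_ge0//; exists x.
    - by rewrite in_itv /= leey lee_fin divr_ge0// exprn_ge0.
    - by rewrite UE; exact: diam_dyadic_cube.
  rewrite poweR_EFin powRM ?invr_ge0 ?exprn_ge0// UE.
  rewrite [mu _]mu_fin; last exact: measurable_dyadic_cube.
  rewrite lee_fin -mulrA ler_wpM2l ?powR_ge0//.
  move: hn; rewrite /heavy [X in (_ < X)%E]mu_fin;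
    last exact: measurable_dyadic_cube.
  rewrite lte_fin => /ltW hn; rewrite ler_pdivlMl ?ltr0n//.
  apply: le_trans hn; rewrite -!powR_mulrn ?powR_ge0// -!powRN -!powRrM.
  by rewrite mulrN mulNr (mulrC s).
apply: (@le_trans _ _ (\sum_(0 <= i <oo) diam_pow s (U i))%E).
  apply: ereal_inf_lbound; exists U => //; split=> [x Xx|j].
    (* The coarsest heavy cube around [x] is a selected one, since all points of a cube share its
       ancestors. *)
    have /cid[n hn] := XP x Xx L.
    have exn : exists n, `[< heavy L n (dyadic_index n x) >] by exists n;
      apply/asboolP.
    case: (ex_minnP exn) => {hn}n /asboolP hn nmin.
    exists (pickle (n, dyadic_index n x)) => //; rewrite /U pickleK_inv.
    case: asboolP => // -[]; split=> // y m yn mn;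
      rewrite (dyadic_index_nested (ltnW mn) yn).
    by move=> /asboolP/nmin; rewrite leqNgt mn.
  have [->|/set0P[x Ux]] := eqVneq (U j) set0.
    by apply: ge_ereal_sup => _ [p [[]]].
  have [n [_ [hn _] UE]] := UP _ _ Ux; rewrite UE.
  apply: (le_trans (diam_dyadic_cube _ _)); rewrite lee_fin (le_trans _ Nn0)//.
  rewrite ler_wpM2l// lef_pV2 ?posrE ?exprn_gt0// ler_eXn2l ?ltr1n//.
  rewrite leqNgt; apply/negP => nn0.
  have := lt_le_trans hn (mu_le _ (measurable_dyadic_cube _ _)).
  rewrite lte_fin ltr_pdivrMr ?exprn_gt0// ltNge => /negP; apply.
  rewrite (le_trans _ Ln0)// ler_wpM2l// ler_weXn2l// ltnW//.
apply: (@le_trans _ _ (\sum_(0 <= i <oo) (N%:R `^ s / L%:R)%:E * mu (U i))%E).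
  by apply: lee_nneseries => // j _ _; exact: diam_pow_ge0.
rewrite nneseriesZl// -measure_semi_bigcup//; last exact: bigcup_measurable.
have K0 : (0 <= (N%:R `^ s / L%:R)%:E)%E by rewrite lee_fin divr_ge0// powR_ge0.
have mUU : measurable (\bigcup_i U i : set (borel E)) by exact: bigcup_measurable.
by rewrite (le_trans (lee_wpmul2l K0 (mu_le _ mUU)))// lee_fin mulrAC.
Qed.

(** If all the sets [A L] were null, the complement of their union would have full measure, and each
    of its points would have heavy cubes around it for every threshold; by [hausdorff_measure_heavy]
    the dimension of [mu] would be at most [s]. *)
Lemma exists_frostman_set : (s%:E < hausdorff_dim_measure mu)%E ->
  exists (L : nat) (A : set E),
    [/\ measurable (A : set (borel E)), (0 < mu A)%E,
        forall x i, A x -> `|x 0 i| <= L%:R &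
        forall n q, (mu (A `&` dyadic_cube n q) <= (L%:R / (2 `^ s) ^+ n)%:E)%E].
Proof.
move=> s_dim; pose A L : set E := [set x : E | (forall i, `|x 0 i| <= L%:R) /\
  forall n, ~ heavy L n (dyadic_index n x)].
have mA L : measurable (A L : set (borel E)).
  have -> : A L = (\bigcap_(i in [set: 'I_N])
      ([set x : E | x 0 i <= L%:R] `&` [set x : E | - L%:R <= x 0 i])) `&`
      \bigcap_n ~` \bigcup_q (if heavy L n q then dyadic_cube n q else set0).
    apply/seteqP; split => x [xL xh]; split.
    - by move=> i _ /=; have := xL i; rewrite ler_norml => /andP[].
    - move=> n _ [q _]; case: ifPn => // hq qx; apply: (xh n).
      by move: qx; rewrite /dyadic_cube /= => ->.
    - by move=> i; have [] := xL i Logic.I; rewrite /= ler_norml => -> ->.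
    - move=> n xn; apply: (xh n Logic.I); exists (dyadic_index n x) => //.
      by rewrite xn.
  apply: measurableI.
    apply: fin_bigcap_measurable => [|i _]; first exact: finite_finset.
    by apply: measurableI; [exact: measurable_coord_le|exact:
      measurable_coord_ge].
  apply: bigcapT_measurable => n; apply: measurableC.
  apply: countable_bigcupT_measurable => [|q]; first exact: countableP.
  by case: ifP => // _; exact: measurable_dyadic_cube.
have [L muA] : exists L, (0 < mu (A L))%E.
  apply: contrapT => /forallNP mu0.
  suff : (hausdorff_dim_measure mu <= s%:E)%E by rewrite leNgt s_dim.
  pose X := ~` \bigcup_L A L.
  have mX : measurable (X : set (borel E)).
    by apply: measurableC; exact: bigcup_measurable.
  apply: (@le_trans _ _ (hausdorff_dim X)).
    apply: ereal_inf_lbound; exists X => //; split=> //.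
    rewrite /full_measure setCK; apply: measure_negligible;
      first exact: bigcup_measurable.
    apply: negligible_bigcup => L; exists (A L); split=> //.
    by apply/eqP; rewrite eq_le measure_ge0 andbT leNgt; apply/negP; exact: mu0.
  apply: ereal_inf_lbound; exists s => //; split=> //.
  apply: hausdorff_measure_heavy => x Xx L.
  (* One parameter bounds both the coordinates and the cube masses in [A], so it must exceed [L] and
     the norm of [x] together. *)
  pose L' := (L + Num.truncn (enorm x)).+1.
  have [n /heavy_antimono hn] : exists n, heavy L' n (dyadic_index n x).
    apply: contrapT => /forallNP xh; apply: Xx; exists L' => //; split=> // i.
    rewrite (le_trans (coord_le_enorm _ _))// (le_trans (ltW (truncnS_gt _)))//.
    by rewrite ler_nat ltnS leq_addl.
  by exists n; apply: hn; rewrite /L' leqW// leq_addr.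
exists L, (A L); split=> // [x i [+ _]|n q]; first exact.
(* A single point of [A L] in the cube certifies that the whole cube is not heavy. *)
have [->|/set0P[x [[_ xh] xq]]] := eqVneq (A L `&` dyadic_cube n q) set0.
  by rewrite measure0 lee_fin divr_ge0// exprn_ge0// ltW.
have {xh} := xh n; rewrite xq => /negP.
rewrite -leNgt; apply: le_trans; apply: le_measure; rewrite ?inE//.
- by apply: measurableI => //; exact: measurable_dyadic_cube.
- exact: measurable_dyadic_cube.
Qed.

End frostman.

(** * Inner regularity *)

Section inner_regularity.
Context {R : realType} {T : ptopologicalType}.
Variable mu : {finite_measure set (borel T) -> \bar R}.
Hypothesis open_Fsigma : forall U : set T, open U -> Fsigma U.

Let inner (A : set T) := forall e : R, 0 < e ->
  exists F : set T, [/\ closed F, F `<=` A & (mu (A `\` F) <= e%:E)%E].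

Let sum_bound (X : set T) (D : (set T)^nat) (e : R) : 0 <= e ->
  measurable (X : set (borel T)) -> (forall i,
    measurable (D i : set (borel T))) ->
  X `<=` \bigcup_i D i -> (forall i, mu (D i) <= (e / (2 ^ i.+1)%:R)%:E)%E ->
  (mu X <= e%:E)%E.
Proof.
move=> e0 mX mD XD De; apply: le_trans (epsilon_trick0 xpredT e0).
apply: le_trans (measure_sigma_subadditive mu mD mX XD) _.
by apply: lee_nneseries => [i _ _|i _]; [exact: measure_ge0|exact: De].
Qed.

Let inner_bigcap (A : (set T)^nat) :
  (forall i, measurable (A i : set (borel T))) -> (forall i, inner (A i)) ->
  inner (\bigcap_i A i).
Proof.
move=> mA iA e e0.
have /choice[F FP] : forall i, exists F : set T, [/\ closed F, F `<=` A i &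
    (mu (A i `\` F) <= (e / (2 ^ i.+1)%:R)%:E)%E].
  by move=> i; apply: iA; rewrite divr_gt0// ltr0n expn_gt0.
have cF i : closed (F i) by case: (FP i).
exists (\bigcap_i F i); split.
- by apply: closed_bigI.
- by move=> x Fx i _; case: (FP i) => _ + _; apply; exact: Fx.
- apply: (@sum_bound _ (fun i => A i `\` F i)) => [||i||i].
  + exact: ltW.
  + by apply: measurableD; [exact: bigcapT_measurable|apply:
    borel_measurable_closed; exact: closed_bigI].
  + by apply: measurableD => //; exact: borel_measurable_closed.
  + move=> x [Ax nFx]; have : (~` \bigcap_i F i) x by []; rewrite setC_bigcap =>
    -[i _ Fx].
    by exists i => //; split=> //; exact: Ax.
  + by case: (FP i).
Qed.

(** The union of the closed approximations need not be closed, so it is cut to a finite union [G n].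
    Half of [e] goes to the approximations, and continuity from above of the finite measure makes
    the cut affordable. *)
Let inner_bigcup (A : (set T)^nat) :
  (forall i, measurable (A i : set (borel T))) -> (forall i, inner (A i)) ->
  inner (\bigcup_i A i).
Proof.
move=> mA iA e e0.
have e20 : 0 < e / 2 by rewrite divr_gt0.
have /choice[F FP] : forall i, exists F : set T, [/\ closed F, F `<=` A i &
    (mu (A i `\` F) <= (e / 2 / (2 ^ i.+1)%:R)%:E)%E].
  by move=> i; apply: iA; rewrite divr_gt0// ltr0n expn_gt0.
have cF i : closed (F i) by case: (FP i).
pose G n := \bigcup_(i in `I_n) F i.
have cG n : closed (G n) by apply: closed_bigcup => //; exact: finite_II.
have mAU : measurable (\bigcup_i A i : set (borel T)) by exact: bigcup_measurable.
pose B n : set (borel T) := \bigcup_i A i `\` G n.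
have mB n : measurable (B n).
  by apply: measurableD => //; exact: borel_measurable_closed.
have BE : \bigcap_n B n = \bigcup_i A i `\` \bigcup_i F i.
  apply/seteqP; split => x.
    move=> Bx; split; first by case: (Bx 0%N Logic.I).
    move=> [i _ Fx]; case: (Bx i.+1 Logic.I) => _; apply.
    by exists i => //=.
  by move=> [Ax nF] n _; split=> // -[i _ Fx]; apply: nF; exists i.
have mBI : measurable (\bigcap_n B n) by exact: bigcapT_measurable.
have muBI : (mu (\bigcap_n B n) <= (e / 2)%:E)%E.
  apply: (@sum_bound _ (fun i => A i `\` F i)) => //.
  - exact: ltW.
  - by move=> i; apply: measurableD => //; exact: borel_measurable_closed.
  - rewrite BE => x [[i _ Ax] nF]; exists i => //; split=> // Fx.
    by apply: nF; exists i.
  - by move=> i; case: (FP i).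
have B_cvg : mu \o B @ \oo --> mu (\bigcap_n B n).
  apply: nonincreasing_cvg_mu => //; first by rewrite ltey_eq fin_num_measure.
  move=> m n mn; apply/subsetPset => x [Ax nG]; split=> // -[i im Fx].
  by apply: nG; exists i => //=; exact: leq_trans mn.
have [n Be] : exists n, (mu (B n) <= e%:E)%E.
  apply: contrapT => /forallNP Be; have : (e%:E <= (e / 2)%:E)%E.
    apply: le_trans muBI; rewrite -(cvg_lim _ B_cvg)//.
    apply: lime_ge; first by apply/cvg_ex; exists (mu (\bigcap_n B n)).
    by near=> n; rewrite ltW// ltNge; apply/negP; exact: Be.
  by rewrite lee_fin ler_pdivlMr// ger_pMr// leNgt ltr1n.
exists (G n); split=> // x [i _ Fx]; exists i => //.
by case: (FP i) => _ + _; exact.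
Unshelve. all: by end_near. Qed.

(** The sets that are approximable together with their complements form a sigma-algebra; it contains
    the open sets because these are countable unions of closed sets. *)
Lemma closed_inner_regular (A : set (borel T)) (e : R) : measurable A -> 0 < e ->
  exists F : set T, [/\ closed F, F `<=` A & (mu (A `\` F) <= e%:E)%E].
Proof.
move=> mA; suff [_ iA _] : [/\ measurable A, inner A & inner (~` A)] by exact: iA.
have closed_inner (F : set T) : closed F -> inner F.
  by move=> cF d d0; exists F; split=> //; rewrite setDv measure0 lee_fin ltW.
pose G := [set A : set T | [/\ measurable (A : set (borel T)),
  inner A & inner (~` A)]].
suff GA : <<s open >> `<=` G by exact: GA mA.
apply: smallest_sub; last first.
  move=> U oU; split.
  - exact: sub_sigma_algebra.
  - have [F cF ->] := open_Fsigma oU; apply: inner_bigcup => i.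
      exact: borel_measurable_closed.
    exact: closed_inner.
  - by apply: closed_inner; exact: open_closedC.
split=> [|B [mB iB iCB]|B GB].
- split; first exact: measurable0.
    exact/closed_inner/closed0.
  by rewrite setC0; exact/closed_inner/closedT.
- by rewrite setTD; split; [exact: measurableC| |rewrite setCK].
- split; first by apply: bigcup_measurable => i _; case: (GB i).
    by apply: inner_bigcup => i; case: (GB i).
  by rewrite setC_bigcup; apply: inner_bigcap => i; case: (GB i) => // *;
    exact: measurableC.
Qed.

End inner_regularity.

(** The n-th closed set consists of the points at distance at least 1/(n + 1) from the complement of
    [U]. *)
Lemma open_Fsigma_normed (R : realType) (V : normedModType R) (U : set V) :
  open U -> Fsigma U.
Proof.
move=> oU; exists (fun n => ~` \bigcup_(y in ~` U) ball y n.+1%:R^-1).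
  by move=> n; apply: open_closedC; apply: bigcup_open => y _; exact: ball_open.
apply/seteqP; split => x.
  move=> Ux; have /nbhs_ballP[e /= e0 xeU] := open_nbhs_nbhs (conj oU Ux).
  have [n _ /(_ n (leqnn _)) /= ne] := near_infty_natSinv_lt (PosNum e0).
  exists n => // -[y nUy yx]; apply: nUy; apply: xeU.
  by apply: ball_sym; apply: le_ball yx; exact: ltW.
move=> [n _ nx]; apply: contrapT => nUx; apply: nx; exists x => //.
exact: ballxx.
Qed.

(** * Compact subsets and quantitative injectivity *)

Section compact_sets.
Context {R : realType} {N : nat}.
Local Notation E := 'rV[R]_N.

(** A closed inner approximation losing at most half of mu(A) keeps positive mass, and boundedness
    makes it compact. *)
Lemma exists_compact_subset (mu : {finite_measure set (borel E) -> \bar R})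
    (A : set (borel E)) (L : R) : measurable A -> (0 < mu A)%E ->
  (forall x i, A x -> `|x 0 i| <= L) ->
  exists K : set E, [/\ compact K, K `<=` A, measurable (K : set (borel E)) & (0
    < mu K)%E].
Proof.
move=> mA muA AL; have muAE : mu A = (fine (mu A))%:E.
  by rewrite fineK// fin_num_measure.
have e0 : 0 < fine (mu A) / 2 by rewrite divr_gt0// -lte_fin -muAE.
have [F [cF FA AF]] := closed_inner_regular mu (@open_Fsigma_normed R E) mA e0.
have mF : measurable (F : set (borel E)) by exact: borel_measurable_closed.
exists F; split=> //.
  apply: bounded_closed_compact => //; exists `|L|; split; first exact: num_real.
  move=> M LM x /FA Ax; change (mx_norm x <= M).
  have [->|/mx_norm_neq0[[i j] ->]] := eqVneq (mx_norm x) 0.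
    by rewrite (le_trans _ (ltW LM)).
  by rewrite ord1 /= (le_trans (AL _ _ Ax))// (le_trans (ler_norm _)) ?ltW.
rewrite lt_neqAle measure_ge0 andbT eq_sym; apply/eqP => F0.
move: AF; have -> : mu (A `\` F) = mu A.
  have AFE : A `&` F = F by exact: setIidr.
  by rewrite [RHS](measureDI mu mA mF) AFE [X in (_ + X)%E]F0 adde0.
by rewrite muAE lee_fin leNgt ltr_pdivrMr// ltr_pMr ?ltr1n// -lte_fin -muAE.
Qed.

Lemma continuous_enorm : continuous (enorm : E -> R).
Proof.
move=> u; rewrite /enorm /dot; apply: continuous_comp;
  last exact: sqrt_continuous.
apply: continuous_big => [[a b]|i _ v]; first exact: add_continuous.
by apply: continuousM; exact: coord_continuous.
Qed.

Lemma continuous_enorm_orthproj_vec (V : {vspace E}) :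
  continuous (fun u => enorm (orthproj V u)).
Proof.
move=> u; rewrite /enorm /dot; apply: continuous_comp;
  last exact: sqrt_continuous.
have cV i : continuous (fun u => orthproj V u 0 i).
  have -> : (fun u => orthproj V u 0 i) = fun u =>
    \sum_j u 0 j * lin1_mx (orthproj V) j i.
    by apply/funext => v; rewrite -[orthproj V v]mul_rV_lin1 mxE.
  apply: continuous_big => [[a b]|j _ v]; first exact: add_continuous.
  by apply: continuousM; [exact: coord_continuous|exact: cst_continuous].
apply: continuous_big => [[a b]|i _ v]; first exact: add_continuous.
by apply: continuousM; exact: cV.
Qed.

(** On the compact set of pairs of [K] at distance at least [e], |P_V (x - y)| attains a minimum,
    positive by injectivity; half of it serves as [d]. *)
Lemma compact_inj_modulus (K : set E) (V : {vspace E}) (e : R) :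
  compact K -> set_inj K (orthproj V) -> 0 < e ->
  exists2 d, 0 < d & forall x y, K x -> K y -> enorm (orthproj V (x - y)) <= d ->
    enorm (x - y) <= e.
Proof.
move=> cK injK e0.
pose D : set (E * E) := (K `*` K) `&` [set p | e <= enorm (p.1 - p.2)].
have csub : continuous (fun p : E * E => p.1 - p.2).
  by move=> p; apply: continuousB; [exact: cvg_fst|exact: cvg_snd].
have cD : compact D.
  apply: compact_closedI; first exact: compact_setX.
  apply: (preimage_closed _ (@closed_ge _ e)) => p _.
  by apply: (continuous_comp (csub p)); exact: continuous_enorm.
have [D0|D0] := eqVneq D set0.
  exists 1 => // x y Kx Ky _; rewrite leNgt; apply/negP => /ltW xy.
  by have : D (x, y) by []; rewrite D0.
pose f (p : E * E) := enorm (orthproj V (p.1 - p.2)).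
have [|c] := compact_EVT_min (f := f) ((set0P D).1 D0) cD.
  apply: continuous_subspaceT => p.
  apply: (@continuous_comp _ _ _ (fun p : E * E => p.1 - p.2)
    (fun u => enorm (orthproj V u))).
    exact: csub.
  exact: continuous_enorm_orthproj_vec.
rewrite inE => -[[Kc1 Kc2] /= ec] cmin.
have f0 : 0 < enorm (orthproj V (c.1 - c.2)).
  apply: enorm_gt0; rewrite linearB subr_eq0; apply/eqP => /injK.
  rewrite !inE => /(_ Kc1 Kc2) c12; move: ec; rewrite c12 subrr enorm0.
  by rewrite leNgt e0.
exists (enorm (orthproj V (c.1 - c.2)) / 2); first by rewrite divr_gt0.
move=> x y Kx Ky; apply: contraTT; rewrite -!ltNge => /ltW exy.
have /cmin : (x, y) \in D by rewrite inE.
by apply: lt_le_trans; rewrite ltr_pdivrMr// ltr_pMr ?ltr1n.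
Qed.

End compact_sets.

(** * Energies *)

Lemma sqr_sum_le_card (R : realFieldType) (I : finType) (S : I -> R) :
  (\sum_i S i) ^+ 2 <= #|I|%:R * \sum_i S i ^+ 2.
Proof.
set t := \sum_i S i; set c : R := #|I|%:R.
have [I0|I0] := posnP #|I|.
  rewrite /t big1 => [|i _]; last by have := card0_eq I0 i.
  by rewrite expr0n mulr_ge0// sumr_ge0// => i _; exact: sqr_ge0.
have : 0 <= \sum_i (c * S i - t) ^+ 2 by apply: sumr_ge0 => i _; exact: sqr_ge0.
have -> : \sum_i (c * S i - t) ^+ 2 =
    \sum_i (c ^+ 2 * S i ^+ 2 + ((- 2 * c * t) * S i + t ^+ 2)).
  by apply: eq_bigr => i _; ring.
rewrite !big_split/= -!mulr_sumr sumr_const -/t -[t *+ _]mulr_natl -[X in t * (X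
  * _)]/c.
have c0 : 0 < c by rewrite ltr0n.
move: (\sum_i S i ^+ 2) => q h; rewrite -(ler_pM2l c0) -subr_ge0 (le_trans h)//.
by rewrite le_eqVlt; apply/orP; left; apply/eqP; ring.
Qed.

(** Cauchy-Schwarz for the class sums: few classes force much mass on pairs within one class. This
    is the discrete form of covering P_V(K) by small pieces. *)
Lemma sqr_sum_le_classes (R : realFieldType) (I J : finType) (h : I -> J) (b : I
  -> R) :
  (\sum_i b i) ^+ 2 <= #|J|%:R * \sum_i \sum_(i' | h i' == h i) b i * b i'.
Proof.
rewrite (partition_big h xpredT)//= (le_trans (sqr_sum_le_card _))// ler_wpM2l//.
rewrite [leRHS](partition_big h xpredT)//=; apply: ler_sum => j _.
rewrite expr2 mulr_suml ler_sum// => i /eqP <-.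
by rewrite mulr_sumr.
Qed.

Section levels.
Context {N m : nat}.
Implicit Types p : {ffun 'I_N -> 'I_m}.

(* p and p' index dyadic cubes of side 2^-n; the level is the largest j <= n such
   that these are at distance O(2^-j). *)
Definition near_cells n j p p' := (j == 0) ||
  [forall i, (p i <= p' i + 2 ^ (n - j)) && (p' i <= p i + 2 ^ (n - j))]%N.

Definition level n p p' := \max_(j < n.+1 | near_cells n j p p') j.

Lemma level_le n p p' : (level n p p' <= n)%N.
Proof. by apply/bigmax_leqP => j _; rewrite -ltnS. Qed.

Lemma near_level n p p' : near_cells n (level n p p') p p'.
Proof.
have [|j nj lj] := @eq_bigmax_cond _ [pred j : 'I_n.+1 | near_cells n j p p']
  (@nat_of_ord _).
  by apply/card_gt0P; exists ord0; rewrite inE /near_cells eqxx.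
by rewrite /level lj.
Qed.

Lemma level_ge n j p p' : (j <= n)%N -> near_cells n j p p' -> (j <= level n p
  p')%N.
Proof.
move=> jn nj; have jn1 : (j < n.+1)%N by [].
exact: (@leq_bigmax_cond _ _ _ (Ordinal jn1)).
Qed.

(** Bounding the term of level l by the sum of (2^k theta)^j over all levels j at which the cells
    are near allows an exchange of sums. Of the two factors theta in the mass bound, one absorbs the
    weight; the other leaves a geometric series with sum at most theta / (theta - 1). *)
Lemma level_sum_le (R : realFieldType) (k n : nat) (theta B C : R)
    (a : {ffun 'I_N -> 'I_m} -> R) (g : {ffun 'I_N -> 'I_m} -> R) p :
  1 < theta -> 0 <= C -> (forall p', 0 <= a p') ->
  (forall j, (j <= n)%N ->
    \sum_(p' | near_cells n j p p') a p' <= B / (2 ^+ k * theta ^+ 2) ^+ j) ->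
  (forall p', g p' <= C / (2 ^+ (n - level n p p')) ^+ k) ->
  \sum_p' a p' * theta ^+ level n p p' * g p' <=
    C * B * theta / (theta - 1) / (2 ^+ n) ^+ k.
Proof.
move=> t1 C0 a0 aB gC.
have t0 : 0 < theta by exact: lt_trans t1.
have B0 : 0 <= B.
  by have := aB 0 (leq0n n); rewrite expr0 divr1; apply: le_trans;
    exact: sumr_ge0.
pose x := theta * 2 ^+ k.
have x0 : 0 < x by rewrite mulr_gt0 ?exprn_gt0.
have wE p' : theta ^+ level n p p' * g p' <=
    C / (2 ^+ n) ^+ k * \sum_(j < n.+1 | near_cells n j p p') x ^+ j.
  apply: (@le_trans _ _ (C / (2 ^+ n) ^+ k * x ^+ level n p p')).
    have -> : C / (2 ^+ n) ^+ k * x ^+ level n p p' =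
        theta ^+ level n p p' * (C / (2 ^+ (n - level n p p')) ^+ k).
      rewrite -{1}(subnK (level_le n p p')) exprD /x !exprMn -!exprM (mulnC k).
      have two0 l : 2 ^+ l != 0 :> R by rewrite expf_neq0.
      move: (two0 (level n p p' * k)%N) (two0 ((n - level n p p') * k)%N).
      move: (2 ^+ _) (2 ^+ _) (theta ^+ _) => u v w u0 v0.
      by field; rewrite u0 v0.
    by rewrite ler_wpM2l// exprn_ge0// ltW.
  rewrite ler_wpM2l ?divr_ge0 ?exprn_ge0//.
  have ln : (level n p p' < n.+1)%N by rewrite ltnS level_le.
  rewrite (bigD1 (Ordinal ln)) /= ?near_level// lerDl sumr_ge0// => j _.
  by rewrite exprn_ge0// ltW.
apply: (@le_trans _ _ (C / (2 ^+ n) ^+ k *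
    \sum_(j < n.+1) x ^+ j * \sum_(p' | near_cells n j p p') a p')).
  have -> : \sum_(j < n.+1) x ^+ j * \sum_(p' | near_cells n j p p') a p' =
      \sum_p' a p' * \sum_(j < n.+1 | near_cells n j p p') x ^+ j.
    under eq_bigr do rewrite mulr_sumr.
    rewrite (exchange_big_dep xpredT)//=; apply: eq_bigr => p' _.
    by rewrite mulr_sumr; apply: eq_bigr => j _; rewrite mulrC.
  rewrite mulr_sumr ler_sum// => p' _; rewrite mulrCA -mulrA ler_wpM2l//.
rewrite [leRHS](_ : _ = C / (2 ^+ n) ^+ k * (B * theta / (theta - 1)));
  last by ring.
rewrite ler_wpM2l ?divr_ge0 ?exprn_ge0//.
apply: (@le_trans _ _ (B * \sum_(j < n.+1) theta^-1 ^+ j)).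
  rewrite mulr_sumr; apply: ler_sum => j _.
  have jn : (j <= n)%N by rewrite -ltnS.
  rewrite (le_trans (ler_wpM2l _ (aB j jn))) ?exprn_ge0 ?(ltW x0)//.
  rewrite mulrCA ler_wpM2l// -expr_div_n le_eqVlt; apply/orP; left; apply/eqP.
  congr (_ ^+ _); rewrite /x; field.
  by rewrite gt_eqF//= expf_neq0.
rewrite -mulrA ler_wpM2l//.
have th1 : theta - 1 != 0 by rewrite subr_eq0 gt_eqF.
have := subrX1 theta^-1 n.+1.
have y0 : 0 < theta^-1 ^+ n.+1 by rewrite exprn_gt0// invr_gt0.
move: (\sum_(_ < _) _) (theta^-1 ^+ _) y0 => S y y0 yS.
have -> : S = theta / (theta - 1) - y * (theta / (theta - 1)).
  have -> : y = 1 + (theta^-1 - 1) * S by rewrite -yS; ring.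
  by field; rewrite th1 gt_eqF.
by rewrite gerBl mulr_ge0 ?(ltW y0)// divr_ge0 ?(ltW t0)// subr_ge0 ltW.
Qed.

End levels.

(** * Finite families of dyadic cells and their masses *)

Section finite_unions.
Context d (T : measurableType d) (R : realType) (mu : {measure set T -> \bar R}).
Context (I : finType) (P : pred I) (D : I -> set T).
Hypothesis mD : forall i, measurable (D i).

Lemma measure_bigcup_fintype : trivIset setT D ->
  mu (\bigcup_(i in [set` P]) D i) = (\sum_(i | P i) mu (D i))%E.
Proof.
move=> tD; rewrite measure_fin_bigcup//.
- rewrite [RHS](@bigfs _ _ _ _ (index_enum I) P) ?index_enum_uniq// => i _.
  by rewrite mem_index_enum.
- exact: sub_trivIset tD.
Qed.

Lemma measure_le_sum_fintype (X : set T) : measurable X ->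
  X `<=` \bigcup_(i in [set` P]) D i -> (mu X <= \sum_(i | P i) mu (D i))%E.
Proof.
move=> mX XD; rewrite [leRHS](@bigfs _ _ _ _ (index_enum I) P)
  ?index_enum_uniq//; last first.
  by move=> i _; rewrite mem_index_enum.
by apply: content_sub_fsum => //; exact: finite_finset.
Qed.

End finite_unions.

Section bounded_floor.
Context {R : realType}.
Implicit Types (b : nat) (z : R).

(** The shift by [b] makes the 2b + 1 possible floors of reals in [-b, b] into ordinals; outside
    this interval the value is meaningless. *)
Definition floor_ord b z : 'I_(2 * b).+1 := inord `|(Num.floor z + b%:Z)%R|%N.

Lemma floor_ordE b z : `|z| <= b%:R -> (floor_ord b z)%:Z = Num.floor z + b%:Z.
Proof.
rewrite ler_norml => /andP[zl zu].
have lo : - b%:Z <= Num.floor z by rewrite floor_ge_int rmorphN.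
have hi : Num.floor z <= b%:Z by rewrite -[leRHS](@intrKfloor R) le_floor.
have f0 : 0 <= Num.floor z + b%:Z by rewrite -lerBlDr sub0r.
have f1 : Num.floor z + b%:Z <= (2 * b)%:Z by rewrite mul2n -addnn PoszD lerD2r.
by rewrite inordK ?ltnS -?lez_nat (gez0_abs f0).
Qed.

Lemma floor_ord_inj b z z' : `|z| <= b%:R -> `|z'| <= b%:R ->
  floor_ord b z = floor_ord b z' -> `|z - z'| <= 1.
Proof.
move=> zb z'b /(congr1 (fun i : 'I__ => (i : nat)%:Z)); rewrite !floor_ordE// =>
  /addIr zz'.
have := floor_itv z; have := floor_itv z'; rewrite zz' intrD.
by move=> /andP[? ?] /andP[? ?]; rewrite ler_norml; apply/andP; split; lra.
Qed.

End bounded_floor.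

Section cells.
Context {R : realType} {N : nat} (L : nat).
Local Notation E := 'rV[R]_N.

(** Indices are shifted by L 2^n, so that the cells cover [-L, L]^N; the extra index is for
    coordinates equal to L, as cubes are half-open. *)
Definition cells n := {ffun 'I_N -> 'I_(2 * (L * 2 ^ n)).+1}.

Definition cell n (p : cells n) : set E :=
  dyadic_cube n [ffun i => (p i)%:Z - (L * 2 ^ n)%:Z].

Lemma measurable_cell n (p : cells n) : measurable (cell p : set (borel E)).
Proof. exact: measurable_dyadic_cube. Qed.

Lemma cell_coord n (p : cells n) (x : E) : cell p x -> forall i,
  (p i)%:R - (L * 2 ^ n)%:R <= 2 ^+ n * x 0 i < (p i)%:R - (L * 2 ^ n)%:R + 1.
Proof.
move=> px i; have /ffunP/(_ i) := px; rewrite !ffunE => /eqP; rewrite floor_eq.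
by rewrite !intrD mulrNz.
Qed.

Lemma cell_inj n (p p' : cells n) (x : E) : cell p x -> cell p' x -> p = p'.
Proof.
rewrite /cell /dyadic_cube /= => -> /ffunP pp'; apply/ffunP => i.
by have := pp' i; rewrite !ffunE => /addIr[] /val_inj.
Qed.

Lemma cell_cover n (x : E) : (forall i, `|x 0 i| <= L%:R) -> exists p : cells n,
  cell p x.
Proof.
move=> xL; exists [ffun i => floor_ord (L * 2 ^ n) (2 ^+ n * x 0 i)].
apply/ffunP => i; rewrite !ffunE floor_ordE ?addrK//.
by rewrite natrM natrX normrM gtr0_norm ?exprn_gt0// mulrC ler_pM2r ?exprn_gt0.
Qed.

Lemma trivIset_cell n (X : set E) : trivIset setT (fun p : cells n =>
  X `&` cell p).
Proof. by move=> p p' _ _ [x [[_ px] [_ p'x]]]; exact: cell_inj px p'x. Qed.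

Section masses.
Variable mu : {finite_measure set (borel E) -> \bar R}.
Implicit Types X Y Z : set (borel E).

Definition mass n X (p : cells n) : R := fine (mu (X `&` cell p)).

Lemma mass_ge0 n X (p : cells n) : 0 <= mass X p.
Proof. exact: fine_ge0. Qed.

Lemma measure_fineK X : measurable X -> mu X = (fine (mu X))%:E.
Proof. by move=> mX; rewrite fineK// fin_num_measure. Qed.

Lemma massE n X (p : cells n) : measurable X -> mu (X `&` cell p) = (mass X p)%:E.
Proof.
by move=> mX; apply: measure_fineK; apply: measurableI => //;
  exact: measurable_cell.
Qed.

Lemma mass_le n X Y (p : cells n) : measurable X -> measurable Y -> X `<=` Y ->
  mass X p <= mass Y p.
Proof.
move=> mX mY XY; rewrite -lee_fin -!massE//; apply: le_measure; rewrite ?inE.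
- by apply: measurableI => //; exact: measurable_cell.
- by apply: measurableI => //; exact: measurable_cell.
- by apply: setSI.
Qed.

Lemma sum_massE n X (P : pred (cells n)) : measurable X ->
  ((\sum_(p | P p) mass X p)%:E = mu (\bigcup_(p in [set` P]) (X `&` cell p)))%E.
Proof.
move=> mX; rewrite measure_bigcup_fintype; first last.
- exact: trivIset_cell.
- by move=> p; apply: measurableI => //; exact: measurable_cell.
by rewrite -sumEFin; apply: eq_bigr => p _; exact/esym/massE.
Qed.

Lemma sum_mass n X : measurable X -> (forall x i,
  X x -> `|(x : E) 0 i| <= L%:R) ->
  \sum_(p : cells n) mass X p = fine (mu X).
Proof.
move=> mX XL; rewrite -[LHS]/(fine _%:E) sum_massE//; congr (fine (mu _)).
apply/seteqP; split => x; first by move=> [p _ []].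
by move=> Xx; have [p px] := @cell_cover n x (XL x ^~ Xx); exists p.
Qed.

End masses.
End cells.

Section growth.
Context {R : realType} {N L : nat}.
Local Notation E := 'rV[R]_N.
Local Notation cells := (@cells N L).

(** In units of 2^-n the distance is below 2^(n - j) + 1, the 1 being the width of a cell; this is
    at most twice 2^(n - j). *)
Lemma near_cell_dist n j (p p' : cells n) (x : E) i : (0 < j <= n)%N ->
  near_cells n j p p' -> cell p' x ->
  `|2 ^+ j * x 0 i - 2 ^+ j * (((p i)%:R - (L * 2 ^ n)%:R) / 2 ^+ n)| < 2.
Proof.
move=> /andP[j0 jn]; rewrite /near_cells eqn0Ngt j0/= =>
  /forallP/(_ i)/andP[pp' p'p] p'x.
have n0 : 0 < 2 ^+ n :> R by rewrite exprn_gt0.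
have j0' : 0 < 2 ^+ (n - j) :> R by rewrite exprn_gt0.
rewrite -(ltr_pM2l j0') -{1}(gtr0_norm j0') -normrM mulrBr !mulrA -!exprD subnK//.
rewrite [X in _ - X](_ : _ = (p i)%:R - (L * 2 ^ n)%:R); last first.
  by rewrite mulrAC divff ?mul1r// gt_eqF.
have := cell_coord p'x i; move: pp' p'p; rewrite -!(ler_nat R) !natrD !natrX.
have : 1 <= 2 ^+ (n - j) :> R by rewrite exprn_ege1// ler1n.
move: (2 ^+ (n - j)) (2 ^+ n * x 0 i) ((L * 2 ^ n)%:R) ((p i)%:R) ((p' i)%:R).
move=> a b c u v ? ? ? /andP[? ?]; rewrite ltr_norml; apply/andP; split; lra.
Qed.

Variables (mu : {finite_measure set (borel E) -> \bar R}) (A : set (borel E)).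
Variables (b B : R).
Hypotheses (mA : measurable A) (b0 : 0 < b) (B0 : 0 <= B).
Hypothesis growth : forall n q, (mu (A `&` dyadic_cube n q) <= (B / b ^+ n)%:E)%E.

(** For j > 0, floors at scale 2^-j of points in near cells differ by at most 2 from those of the
    corner of [p], so 5^N dyadic cubes of side 2^-j suffice. At j = 0 all cells count as near,
    whence the summand mu(A). *)
Lemma sum_mass_near n j (p : cells n) : (j <= n)%N ->
  \sum_(p' | near_cells n j p p') mass mu A p' <=
    ((5 ^ N)%:R * B + fine (mu A)) / b ^+ j.
Proof.
move=> jn; have muA0 : 0 <= fine (mu A) by exact: fine_ge0.
have [->|j0] := posnP j.
  rewrite expr0 divr1 ler_wpDl ?mulr_ge0// -lee_fin sum_massE// -measure_fineK//.
  apply: le_measure; rewrite ?inE//.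
    apply: fin_bigcup_measurable => [|p' _]; first exact: finite_finset.
    by apply: measurableI => //; exact: measurable_cell.
  by move=> x [p' _ []].
rewrite mulrDl ler_wpDr ?divr_ge0 ?exprn_ge0 ?(ltW b0)//.
pose y i : R := ((p i)%:R - (L * 2 ^ n)%:R) / 2 ^+ n.
pose q (e : {ffun 'I_N -> 'I_5}) : {ffun 'I_N -> int} :=
  [ffun i => Num.floor (2 ^+ j * y i) + (e i)%:Z - 2].
rewrite -lee_fin sum_massE//.
have mAq e : measurable (A `&` dyadic_cube j (q e) : set (borel E)).
  by apply: measurableI => //; exact: measurable_dyadic_cube.
apply: (@le_trans _ _ (\sum_e mu (A `&` dyadic_cube j (q e)))%E).
  apply: measure_le_sum_fintype => //.
    apply: fin_bigcup_measurable => [|p' _]; first exact: finite_finset.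
    by apply: measurableI => //; exact: measurable_cell.
  move=> x [p' /= pp' [Ax p'x]].
  have fxy i : 0 <= Num.floor (2 ^+ j * x 0 i) - Num.floor (2 ^+ j * y i) + 2 <=
    4.
    have := @near_cell_dist n j p p' x i _ pp' p'x; rewrite j0 jn => /(_ isT).
    rewrite -/(y i); have := floor_itv (2 ^+ j * x 0 i); have :=
      floor_itv (2 ^+ j * y i).
    rewrite !intrD; set u := Num.floor _; set v := Num.floor _.
    move: (_ * _) (_ * _) => s t /andP[? ?] /andP[? ?]; rewrite ltr_norml =>
      /andP[? ?].
    have h1 : -1 < v - u + 2 by rewrite -(ltr_int R) !intrD mulrNz rmorphN /=;
      lra.
    have h2 : v - u + 2 < 5 by rewrite -(ltr_int R) !intrD mulrNz; lra.
    by move: h1 h2; move: (v - u + 2) => w; lia.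
  exists [ffun i => inord `|(Num.floor (2 ^+ j * x 0 i) - Num.floor (2 ^+ j * y
    i) + 2)%R|%N] => //.
  split=> //; apply/ffunP => i; rewrite !ffunE; have /andP[f0 f4] := fxy i.
  rewrite inordK ?gez0_abs//; first by ring.
  by rewrite ltnS -lez_nat gez0_abs.
rewrite (le_trans (lee_sum _ (fun e _ => growth j (q e))))//.
by rewrite sumEFin sumr_const card_ffun !card_ord -mulrA mulr_natl lexx.
Qed.

End growth.

(** * Bounded averages of the energies *)

(** By Fatou's lemma the lower limit is integrable, hence finite almost everywhere; there, values
    below the lower limit plus 1 occur for arbitrarily large n. *)
Lemma ae_frequently_bounded d (T : measurableType d) (R : realType)
    (mu : {measure set T -> \bar R}) (f : nat -> T -> R) (M : R) :
  (forall n, measurable_fun setT (f n)) -> (forall n x, 0 <= f n x) ->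
  (forall n, \int[mu]_x (f n x)%:E <= M%:E)%E ->
  {ae mu, forall x, exists B : R, forall n0, exists2 n, (n0 <= n)%N & f n x <= B}.
Proof.
move=> mf f0 fM; pose g n x := (f n x)%:E.
have mg n : measurable_fun setT (g n) by exact/measurable_EFinP.
have g0 n x : (0 <= g n x)%E by rewrite lee_fin.
pose h x := limn_einf (g ^~ x).
have mh : measurable_fun setT h.
  rewrite (_ : h = fun x => (- limn_esup (fun n => - g n x))%E)//.
  apply: measurableT_comp => //; apply: measurable_fun_limn_esup => n.
  exact: measurableT_comp.
have hsup x : h x = ereal_sup (range (einfs (g ^~ x))).
  by rewrite /h limn_einf_lim; apply/cvg_lim => //; exact: cvg_einfs_sup.
have h0 x : (0 <= h x)%E.
  rewrite hsup; apply: (@le_trans _ _ (einfs (g ^~ x) 0%N)).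
    by apply: le_ereal_inf_tmp => _ [n _ <-].
  by apply: ereal_sup_ubound; exists 0%N.
have ih : mu.-integrable setT h.
  apply/integrableP; split=> //.
  under eq_integral do rewrite gee0_abs//.
  apply: le_lt_trans (fatou mu measurableT mg (fun n x _ => g0 n x)) _.
  apply: (@le_lt_trans _ _ M%:E); last exact: ltry.
  rewrite limn_einf_lim; apply: lime_le; first exact: is_cvg_einfs.
  near=> n; apply: le_trans (fM n); apply: ereal_inf_lbound.
  by exists n => //=.
have [Z [mZ Z0 hZ]] := integrable_ae measurableT ih.
exists Z; split=> // x /= nx; apply: hZ => /= hx; apply: nx.
have {}hx := hx Logic.I; exists (fine (h x) + 1) => n0.
have : (einfs (g ^~ x) n0 < (fine (h x) + 1)%:E)%E.
  rewrite EFinD fineK//; apply: (@le_lt_trans _ _ (h x)); last first.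
    by rewrite -(fineK hx) -EFinD lte_fin ltrDl.
  by rewrite hsup; apply: ereal_sup_ubound; exists n0.
move=> /ereal_inf_lt[_ [n /= n0n <-]] /ltW; rewrite lee_fin => fn.
by exists n.
Unshelve. all: by end_near. Qed.

Section energy.
Context {R : realType} {N k : nat} (L : nat) {kN : (k <= N)%N}.
Local Notation E := 'rV[R]_N.
Local Notation Gr := (grassmannian R kN).
Local Notation cells := (@cells N L).
Variables (gamma : probability (borel Gr) R) (mu : {finite_measure set (borel E)
  -> \bar R}).
Variables (A : set (borel E)) (theta B : R).
Hypothesis gamma_inv : rotation_invariant gamma.
Hypothesis mA : measurable A.
Hypothesis theta1 : 1 < theta.
Hypothesis B0 : 0 <= B.
Hypothesis growth : forall n q,
  (mu (A `&` dyadic_cube n q) <= (B / (2 ^+ k * theta ^+ 2) ^+ n)%:E)%E.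

Let theta0 : 0 < theta. Proof. exact: lt_trans theta1. Qed.

(** The difference of the grid vectors is 2^n times that of the corners of the cells, so the bound 1
    means 2^-n in space. *)
Definition close_pair n (p p' : cells n) : set (borel Gr) :=
  [set V : Gr | enorm (orthproj V (grid_vec p - grid_vec p')) <= 1].

(* A discretization at scale 2^-n of
   [2^(nk) * \int\int_(|P_V (x - y)| <= 2^-n) |x - y|^(k - t) dmu(x) dmu(y)]
   over A x A, where 2^(t - k) = theta. *)
Definition energy n (V : Gr) : R := \sum_(pp : cells n * cells n)
  (2 ^+ n) ^+ k * (mass mu A pp.1 * mass mu A pp.2 * theta ^+ level n pp.1 pp.2) *
  \1_(close_pair pp.1 pp.2) V.

Let weight_ge0 n (pp : cells n * cells n) :
  0 <= (2 ^+ n) ^+ k * (mass mu A pp.1 * mass mu A pp.2 * theta ^+ level n pp.1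
    pp.2).
Proof. by rewrite !mulr_ge0 ?mass_ge0 ?exprn_ge0// ltW. Qed.

Lemma measurable_close_pair n (p p' : cells n) : measurable (close_pair p p').
Proof. exact: measurable_orthproj_le. Qed.

Lemma measurable_energy n : measurable_fun setT (energy n : borel Gr -> R).
Proof.
apply: measurable_sum => pp; apply: measurable_funM => //.
by apply: measurable_indic; exact: measurable_close_pair.
Qed.

Lemma energy_ge0 n V : 0 <= energy n V.
Proof. by apply: sumr_ge0 => pp _; rewrite mulr_ge0. Qed.

(** Integrating termwise leaves the measures of [close_pair p p']. Cells of level l < n are not near
    at level l + 1, so their grid vectors differ by more than 2^(n - l - 1) in some coordinate and
    [gamma_orthproj_le] applies; [level_sum_le] sums over p', and the masses of the p add up to at
    most mu(A). *)
Lemma integral_energy_bounded : exists M : R, forall n,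
  (\int[gamma]_V (energy n V)%:E <= M%:E)%E.
Proof.
have [C C0 CP] := gamma_orthproj_le gamma_inv.
(* In [C1], the 1 covers pairs of level n, where a probability is just bounded by 1, and 2^k pays
   for [D] below being half of 2^(n - level). [B1] is the constant of [sum_mass_near]. *)
pose C1 := 1 + C * 2 ^+ k; pose B1 := (5 ^ N)%:R * B + fine (mu A).
have C10 : 0 <= C1 by rewrite addr_ge0// mulr_ge0// exprn_ge0.
have close_le n (p p' : cells n) : (gamma (close_pair p p') <=
    (C1 / (2 ^+ (n - level n p p')) ^+ k)%:E)%E.
  have := level_le n p p'; rewrite leq_eqVlt => /orP[/eqP ->|ln].
    rewrite subnn expr0 expr1n divr1 (le_trans (probability_le1 _ _))//.
      exact: measurable_close_pair.
    by rewrite lee_fin lerDl mulr_ge0// exprn_ge0.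
  pose D := (2 ^ (n - (level n p p').+1))%N.
  apply: (@le_trans _ _ (C / D%:R ^+ k)%:E).
    apply: CP; first by rewrite expn_gt0.
    have : ~~ near_cells n (level n p p').+1 p p'.
      by apply/negP => /(level_ge ln); rewrite ltnn.
    rewrite /near_cells /= negb_forall => /existsP[i nearN].
    rewrite (le_trans _ (coord_le_enorm _ i))// !mxE.
    move: nearN; rewrite -/D negb_and -!ltnNge; move: (p i : nat) (p' i : nat) =>
      a b.
    by case/orP; rewrite -(ltr_nat R) natrD => h; rewrite ler_normr; lra.
  rewrite lee_fin /D natrX -(subnSK ln) exprS exprMn invfM mulrA.
  rewrite ler_wpM2r ?invr_ge0 ?exprn_ge0//.
  by rewrite ler_pdivlMr ?exprn_gt0// lerDr.
exists (fine (mu A) * (C1 * B1 * theta / (theta - 1))) => n.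
rewrite /energy integral_sum_indic//; last by move=> pp;
  exact: measurable_close_pair.
pose g (p p' : cells n) := fine (gamma (close_pair p p')).
have gE p p' : gamma (close_pair p p') = (g p p')%:E.
  by rewrite fineK// fin_num_measure//; exact: measurable_close_pair.
rewrite (eq_bigr (fun pp => ((2 ^+ n) ^+ k * (mass mu A pp.1 * mass mu A pp.2 *
  theta ^+ level n pp.1 pp.2) * g pp.1 pp.2)%:E)); last first.
  by move=> pp _; rewrite [RHS]EFinM -gE.
rewrite sumEFin lee_fin -(pair_bigA _ (fun p p' => (2 ^+ n) ^+ k *
  (mass mu A p * mass mu A p' * theta ^+ level n p p') * g p p'))//=.
apply: (@le_trans _ _ (\sum_(p : cells n) mass mu A p * (C1 * B1 * theta / (theta
  - 1)))).
  apply: ler_sum => p _.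
  have := @level_sum_le _ _ R k n theta B1 C1 (mass mu A) (g p) p theta1 C10
    (fun p' => mass_ge0 _ _ p').
  have sumB j : (j <= n)%N -> \sum_(p' | near_cells n j p p') mass mu A p' <=
      B1 / (2 ^+ k * theta ^+ 2) ^+ j.
    by move=> jn; apply: sum_mass_near => //; rewrite mulr_gt0 ?exprn_gt0.
  have gC p' : g p p' <= C1 / (2 ^+ (n - level n p p')) ^+ k.
    by rewrite -lee_fin -gE; exact: close_le.
  move=> /(_ sumB gC); rewrite ler_pdivlMr ?exprn_gt0//.
  move=> /(ler_wpM2l (mass_ge0 mu A p)); apply: le_trans.
  rewrite mulrA mulr_sumr mulr_suml le_eqVlt; apply/orP; left; apply/eqP.
  by apply: eq_bigr => p' _; ring.
rewrite -mulr_suml ler_wpM2r//.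
  have B10 : 0 <= B1 by rewrite addr_ge0 ?mulr_ge0// fine_ge0.
  by rewrite !mulr_ge0// ?invr_ge0 ?subr_ge0 ltW.
rewrite -lee_fin sum_massE// -measure_fineK//; apply: le_measure; rewrite ?inE//.
  apply: fin_bigcup_measurable => [|p' _]; first exact: finite_finset.
  by apply: measurableI => //; exact: measurable_cell.
by move=> x [p' _ []].
Qed.

End energy.

(** * Lower bounds for energies *)

Section energy_lower_bound.
Context {R : realType} {N k L : nat} {kN : (k <= N)%N}.
Hypothesis k0 : (0 < k)%N.
Local Notation E := 'rV[R]_N.
Local Notation Gr := (grassmannian R kN).
Local Notation cells := (@cells N L).

Let N0 : (0 < N)%N. Proof. exact: leq_trans kN. Qed.

Lemma enorm_grid_vec n (p : cells n) :
  enorm (grid_vec p : E) <= (N * (2 * (L * 2 ^ n)))%:R.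
Proof.
rewrite natrM; apply: enorm_le_coord => // i.
by rewrite mxE normr_nat ler_nat -ltnS.
Qed.

(** Cells are classified by the floors of k coordinates of their projected grid vectors, magnified
    by Nk. These coordinates determine a vector of V with coefficients at most 1, so within a class
    every coordinate of the projected difference is at most 1/N, and its norm at most 1. *)
Lemma close_pair_classes : exists C : nat, forall (V : Gr) n,
  exists2 J : finType, (#|J| <= (C * 2 ^ n) ^ k)%N &
  exists h : cells n -> J, forall p p', h p = h p' -> close_pair p p' V.
Proof.
exists (4 * N * N * k * L + 1)%N => V n.
have /eqP/bounded_dual_basis[f [M [MV _ M1 VE]]] := valP V.
pose b := (N * k * (N * (2 * (L * 2 ^ n))))%N.
exists {ffun 'I_k -> 'I_(2 * b).+1}.
  rewrite card_ffun !card_ord leq_exp2r// mulnDl mul1n -addn1 leq_add ?expn_gt0//.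
  by rewrite /b; nia.
pose z (p : cells n) l : R := (N * k)%:R * orthproj V (grid_vec p) 0 (f l).
have zb p l : `|z p l| <= b%:R.
  rewrite /z normrM normr_nat /b [leRHS]natrM ler_wpM2l//.
  rewrite (le_trans (coord_le_enorm _ _))// (le_trans (enorm_orthproj _ _))//.
  exact: enorm_grid_vec.
exists (fun p => [ffun l => floor_ord b (z p l)]) => p p' /ffunP hpp'.
rewrite /close_pair /=; set u := orthproj V _.
have Nk0 : 0 < (N * k)%:R :> R by rewrite ltr0n muln_gt0 N0.
have uf l : (N * k)%:R * `|u 0 (f l)| <= 1.
  have := hpp' l; rewrite !ffunE => /(floor_ord_inj (zb p l) (zb p' l)).
  by rewrite /z -mulrBr normrM normr_nat /u linearB /= !mxE.
have ui i : `|u 0 i| <= k%:R / (N * k)%:R.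
  rewrite ler_pdivlMr// mulrC {1}(VE u (orthproj_mem V _)) summxE.
  apply: (@le_trans _ _ (\sum_(l < k) (1 : R)));
    last by rewrite sumr_const card_ord.
  rewrite (le_trans (ler_wpM2l (ltW Nk0) (ler_norm_sum _ _ _)))// mulr_sumr.
  apply: ler_sum => l _; rewrite !mxE normrM mulrA (le_trans _ (uf l))//.
  by rewrite ler_piMr ?mulr_ge0.
rewrite (le_trans (enorm_le_coord _ ui))//.
by rewrite mulrA -natrM divff// gt_eqF.
Qed.

Variables (mu : {finite_measure set (borel E) -> \bar R}) (A K : set (borel E))
  (theta : R).
Hypotheses (mA : measurable A) (mK : measurable K) (KA : K `<=` A).
Hypothesis cK : compact (K : set E).
Hypothesis KL : forall x i, K x -> `|(x : E) 0 i| <= L%:R.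
Hypothesis theta1 : 1 < theta.

(* If P_V is injective on K, close pairs of cells meeting K are near each other,
   so that they contribute to the energy with a large power of theta; and
   O(2^(nk)) classes of mutually close cells cover K. *)
Lemma energy_lower_bound (V : Gr) (j : nat) : set_inj K (orthproj V) ->
  exists n0, forall n, (n0 <= n)%N -> forall C : nat,
    (exists2 J : finType, (#|J| <= (C * 2 ^ n) ^ k)%N &
      exists h : cells n -> J, forall p p', h p = h p' -> close_pair p p' V) ->
  theta ^+ j * fine (mu K) ^+ 2 <= C%:R ^+ k * energy L mu A theta n V.
Proof.
(* The exponent is j + 1 since passing from points to cell indices costs 1, absorbed by 2^(n - j -
   1) + 1 <= 2^(n - j). *)
move=> injK; have e0 : 0 < (2 ^+ j.+1)^-1 :> R by rewrite invr_gt0 exprn_gt0.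
have [d d0 dP] := compact_inj_modulus cK injK e0.
(* This ensures (1 + N) / 2^n <= d: for points of two close cells, 2^n |P_V (x - y)| is at most 1,
   from the grid vectors, plus N, from the positions inside the cells. *)
pose n1 := (Num.truncn ((1 + N%:R) / d)).+1.
exists (maxn n1 j.+1) => n; rewrite geq_max => /andP[n1n jn] C [J JC [h hP]].
have n0 : 0 < 2 ^+ n :> R by rewrite exprn_gt0.
have level_ge_j (p p' : cells n) : close_pair p p' V -> mass mu K p != 0 -> mass
  mu K p' != 0 ->
    (j <= level n p p')%N.
  move=> pp' mp mp'; apply: level_ge; first exact: ltnW.
  have /set0P[x [Kx px]] : K `&` cell p != set0.
    by apply: contra_neq mp => K0; rewrite /mass K0 measure0.
  have /set0P[y [Ky p'y]] : K `&` cell p' != set0.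
    by apply: contra_neq mp' => K0; rewrite /mass K0 measure0.
  have xE i := cell_coord px i; have yE i := cell_coord p'y i.
  have xy : enorm (x - y) <= (2 ^+ j.+1)^-1.
    apply: dP => //.
    have -> : x - y = (2 ^+ n)^-1 *: ((grid_vec p - grid_vec p') +
        (2 ^+ n *: (x - y) - (grid_vec p - grid_vec p'))).
      by rewrite [in RHS]addrC subrK scalerA mulVf ?scale1r// gt_eqF.
    set w := _ - (_ - _).
    have wN : enorm w <= N%:R.
      rewrite -[leRHS]mulr1; apply: enorm_le_coord => // i; rewrite !mxE.
      rewrite mulrBr; move: (xE i) (yE i).
      by move=> /andP[? ?] /andP[? ?]; rewrite ler_norml; apply/andP; split; lra.
    rewrite linearZ /= enormZ gtr0_norm ?invr_gt0// linearD.
    rewrite ler_pdivrMl//.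
    apply: (@le_trans _ _ (1 + N%:R)).
      rewrite (le_trans (ler_enormD _ _))// lerD//.
      by rewrite (le_trans (enorm_orthproj _ _)).
    rewrite -ler_pdivrMr// (le_trans (ltW (truncnS_gt _)))//.
    by rewrite -natrX ler_nat (leq_trans n1n)// ltnW// ltn_expl.
  rewrite /near_cells; apply/orP; right; apply/forallP => i.
  have xyi : 2 ^+ n * `|x 0 i - y 0 i| <= 2 ^+ (n - j.+1).
    have := le_trans (coord_le_enorm _ i) xy; rewrite !mxE => h1.
    rewrite (le_trans (ler_wpM2l (ltW n0) h1))//.
    by rewrite -{1}(subnK jn) exprD mulfK// expf_neq0.
  have twoE : 2 ^+ (n - j) = 2 * 2 ^+ (n - j.+1) :> R by rewrite -exprS subnSK.
  have : 1 <= 2 ^+ (n - j.+1) :> R by rewrite exprn_ege1// ler1n.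
  move: xyi; rewrite -{1}(gtr0_norm n0) -normrM mulrBr ler_norml.
  move: (xE i) (yE i); rewrite -!(ler_nat R) !natrD !natrX twoE.
  move=> /andP[? ?] /andP[? ?] /andP[? ?] ?; apply/andP; split; lra.
have theta0 : 0 < theta by exact: lt_trans theta1.
rewrite -(sum_mass mu n mK KL).
have JCR : #|J|%:R <= C%:R ^+ k * (2 ^+ n) ^+ k :> R.
  by rewrite -exprMn -!natrX -natrM -natrX ler_nat.
rewrite (le_trans (ler_wpM2l _ (sqr_sum_le_classes h (mass mu K))))//.
  by rewrite exprn_ge0// ltW.
rewrite mulrCA (le_trans (ler_wpM2r _ JCR))//.
  rewrite mulr_ge0 ?exprn_ge0 ?(ltW theta0)// sumr_ge0// => p _.
  by rewrite sumr_ge0// => p' _; rewrite mulr_ge0 ?mass_ge0.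
rewrite -mulrA ler_wpM2l ?exprn_ge0//.
rewrite /energy -(pair_bigA _ (fun p p' => (2 ^+ n) ^+ k *
  (mass mu A p * mass mu A p' * theta ^+ level n p p') * \1_(close_pair p p')
    V))/=.
rewrite !mulr_sumr; apply: ler_sum => p _.
rewrite !mulr_sumr big_mkcond; apply: ler_sum => p' _.
have w0 : 0 <= (2 ^+ n) ^+ k * (mass mu A p * mass mu A p' * theta ^+ level n p
  p').
  by rewrite !mulr_ge0 ?mass_ge0 ?exprn_ge0 ?(ltW theta0).
case: eqP => [/esym/hP pp'|_]; last by rewrite mulr_ge0.
rewrite indicE mem_set// mulr1 ler_wpM2l ?exprn_ge0//.
(* Cells without mass in [K] contribute nothing on the left; only the others are known to meet [K],
   as the level estimate requires. *)
have [->|mp] := eqVneq (mass mu K p) 0.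
  by rewrite mul0r mulr0 !mulr_ge0 ?mass_ge0 ?exprn_ge0 ?(ltW theta0).
have [->|mp'] := eqVneq (mass mu K p') 0.
  by rewrite !mulr0 !mulr_ge0 ?mass_ge0 ?exprn_ge0 ?(ltW theta0).
rewrite mulrC ler_pM ?mulr_ge0 ?mass_ge0 ?exprn_ge0 ?(ltW theta0)//.
  by rewrite ler_pM ?mass_ge0// mass_le.
by rewrite ler_weXn2l ?(ltW theta1)// level_ge_j.
Qed.

End energy_lower_bound.

(** * From bounded energies to failure of injectivity *)

Lemma exists_exprn_gt (R : archiRealFieldType) (theta x : R) :
  1 < theta -> exists j, x < theta ^+ j.
Proof.
move=> t1; have bernoulli j : j%:R * (theta - 1) <= theta ^+ j.
  elim: j => [|j IH]; first by rewrite mul0r.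
  have : 1 <= theta ^+ j by rewrite exprn_ege1// ltW.
  rewrite exprS -natr1; move: (theta ^+ j) IH => y; nra.
exists (Num.truncn (x / (theta - 1))).+1; apply: lt_le_trans (bernoulli _).
by rewrite -ltr_pdivrMr ?subr_gt0// truncnS_gt.
Qed.

Theorem proposition1p4 (R : realType) (N k : nat) (k_gt0 : (0 < k)%N)
    (kN : (k <= N)%N)
    (gamma : probability (borel (grassmannian R kN)) R)
    (gamma_inv : rotation_invariant gamma)
    (mu : {finite_measure set (borel 'rV[R]_N) -> \bar R})
    (mu_dim : (k%:R%:E < hausdorff_dim_measure mu)%E) :
  {ae gamma, forall V : grassmannian R kN,
    forall Y : set (borel 'rV[R]_N), measurable Y -> full_measure mu Y ->
      ~ set_inj Y (orthproj V)}.
Proof.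
have [s ks s_dim] : exists2 s : R, k%:R < s & (s%:E < hausdorff_dim_measure mu)%E.
  case: (hausdorff_dim_measure mu) mu_dim => [r| |//].
    by rewrite lte_fin => kr; exists ((k%:R + r) / 2); rewrite ?lte_fin; lra.
  by move=> _; exists (k%:R + 1); rewrite ?ltry// ltrDl.
have s0 : 0 <= s by rewrite (le_trans _ (ltW ks)).
have [L [A [mA muA AL growth]]] := exists_frostman_set s0 s_dim.
(* This is 2^(t - k) for t midway between k and s, so that 2^k theta^2 = 2^s matches the mass growth
   on [A]. *)
pose theta : R := 2 `^ ((s - k%:R) / 2).
have theta1 : 1 < theta.
  have r0 : 0 < (s - k%:R) / 2 by rewrite divr_gt0// subr_gt0.
  by have := gt0_ltr_powR r0 _ _ (ltr1n R 2); rewrite powR1 !nnegrE; apply.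
have thetaE : 2 ^+ k * theta ^+ 2 = 2 `^ s.
  rewrite /theta -!powR_mulrn ?powR_ge0// -powRrM divfK// -powRD ?subrKC//.
  by rewrite pnatr_eq0 implybT.
have [M energyM] : exists M : R, forall n, (\int[gamma]_V (energy L mu A theta n
  V)%:E <= M%:E)%E.
  apply: (@integral_energy_bounded _ _ _ _ _ _ _ _ _ L%:R) => // n q.
  by rewrite thetaE.
have [C0 C0P] := close_pair_classes (L := L) (kN := kN) (R := R) k_gt0.
(* The energies involve [A] but not [Y], so one null set of subspaces serves all [Y]. *)
have := ae_frequently_bounded (@measurable_energy R N k L kN mu A theta) _
  energyM.
move=> /(_ (fun n V => energy_ge0 _ _ _ theta1 _ _))/filterS; apply =>
  V [Bd BdP] Y mY Yfull injY.
have mAY : measurable (A `&` Y : set (borel 'rV[R]_N)) by exact: measurableI.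
have muAY : (0 < mu (A `&` Y))%E.
  rewrite lt_neqAle measure_ge0 andbT eq_sym; apply/eqP => AY0.
  have : (mu A <= mu (A `&` Y) + mu (~` Y))%E.
    rewrite (measureDI mu mA mY) addeC; apply: leeD => //.
    apply: le_measure; rewrite ?inE//; first exact: measurableD.
      exact: measurableC.
  by rewrite AY0 Yfull adde0 leNgt muA.
have [K [cK KAY mK muK]] := exists_compact_subset mAY muAY (fun x i Ax =>
  AL x i Ax.1).
have KA : K `<=` A by move=> x /KAY[].
have injK : set_inj K (orthproj V).
  by move=> x y; rewrite !inE => /KAY[_ Yx] /KAY[_ Yy]; apply: injY; rewrite inE.
have kappa0 : 0 < fine (mu K) ^+ 2.
  by rewrite exprn_gt0// -lte_fin -measure_fineK.
(* [j] is chosen after [K] and [Bd] so that theta^j mu(K)^2 exceeds C0^k Bd; energies at most [Bd]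
   recur beyond the [n0] belonging to this [j], which contradicts the lower bound. *)
have [j hj] := exists_exprn_gt (C0%:R ^+ k * Bd / fine (mu K) ^+ 2) theta1.
have KL x i : K x -> `|x 0 i| <= L%:R by move=> /KA; exact: AL.
have [n0 low] := energy_lower_bound mu mA mK KA cK KL theta1 (V := V) j injK.
have [n n0n en] := BdP n0.
have := low n n0n C0 (C0P V n); apply/negP; rewrite -ltNge.
rewrite ltr_pdivrMr// in hj; apply: le_lt_trans hj.
by rewrite ler_wpM2l// exprn_ge0.
Qed.
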